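(* The box-counting dimensions of $\Omega$ and $\Omega_\infty$ exist and satisfy $$\mathrm{BD}(\Omega)=\mathrm{BD}(\Omega_\infty)=\mathrm{HD}(\Omega)=\mathrm{HD}(\Omega_\infty)=\frac{\log z^\ast_{\mathcal S}}{\log\alpha},$$ where $z^\ast_{\mathcal S}$ is the smallest real positive number with $$\sum_{i\in\mathcal I}\frac{\mathcal S_i^+(z^\ast_{\mathcal S})}{1+\mathcal S_i^+(z^\ast_{\mathcal S})}=1 .$$
   Context: Groups. Let $r\ge 2$, $\mathcal I=\{1,\dots,r\}$, and let $\Gamma_1,\dots,\Gamma_r$ be non-trivial finitely generated groups with identities $e_i$; the case $r=2=|\Gamma_1|=|\Gamma_2|$ is excluded. Put $\Gamma_i^\times=\Gamma_i\setminus\{e_i\}$. The free product $\Gamma=\Gamma_1\ast\dots\ast\Gamma_r$ is the set of words $x_1\dots x_n$ ($n\ge 1$, $x_j\in\bigcup_i\Gamma_i^\times$, consecutive letters not from the same $\Gamma_i$) together with the empty word $e$; each $\Gamma_i$ is regarded as a subset of $\Gamma$, with $e_i$ identified with $e$. For each $i$ let $S_i$ be a finite symmetric generating set of $\Gamma_i$ with $e_i\notin S_i$ (in the paper, the support of the step distribution $\mu_i$ of a random walk on $\Gamma_i$). $\mathcal X$ is the Cayley graph of $\Gamma$ with respect to $\bigcup_iS_i$, and $l(x)$ is the graph distance from $e$ to $x$. Put $S_i(m)=|\{x\in\Gamma_i: l(x)=m\}|$ and $\mathcal S_i^+(z)=\sum_{m\ge1}S_i(m)z^m$. Ends. A ray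 is a semi-infinite path without repeated vertices; two rays are equivalent if some third ray shares infinitely many vertices with each of them; ends are the equivalence classes. $\Omega$ is the set of ends of $\mathcal X$. $\Omega_\infty\subseteq\Omega$ is the set of infinite words $x_1x_2\dots$ with $x_j\in\bigcup_i\Gamma_i^\times$ and consecutive letters not from the same $\Gamma_i$, identified with the ends they describe. For a finite vertex set $F$, the $\omega$-component of $\mathcal X\setminus F$ is the connected component containing all but finitely many vertices of every ray in $\omega$. Metric and dimensions. Let $B_m=\{x\in\Gamma: l(x)\le m\}$, $B_{-1}=\emptyset$. For distinct $\omega_1,\omega_2\in\Omega$ let $c(\omega_1,\omega_2)$ be the maximal $m\in\{0,1,2,\dots\}$ such that the $\omega_1$- and $\omega_2$-components of $\mathcal X\setminus B_{m-1}$ coincide. Fix $\alpha\in(0,1)$; the metric on $\Omega$ is $d_\Omega(\omega_1,\omega_2)=\alpha^{c(\omega_1,\omega_2)}$ for $\omega_1\neq\omega_2$, and $d_\Omega(\omega,\omega)=0$. Balls $B(\omega,\varepsilon)$ are closed. For $\Omega'\subseteq\Omega$, a cover is a finite or countable family of balls with centers in $\Omega'$ and positive radii whose union contains $\Omega'$. $N_\varepsilon(\Omega')$ is the minimal number of balls centered in $\Omega'$ with radii in $(0,\varepsilon]$ covering $\Omega'$. The lower/upper box-counting dimensions are the $\liminf$/$\limsup$ of $\log N_\varepsilon(\Omega')/(-\log\varepsilon)$ as $\varepsilon\downarrow0$; if they coincide the common value is $\mathrm{BD}(\Omega')$. $\mathcal H_\delta(\Omega')=\lim_{\varepsilon\downarrow0}\inf\{\sum_i\varepsilon_i^\delta:\{B(\cdot,\varepsilon_i)\}_i\text{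 a cover of }\Omega'\text{ with all }\varepsilon_i<\varepsilon\}$ and $\mathrm{HD}(\Omega')=\inf\{\delta\ge0:\mathcal H_\delta(\Omega')=0\}$. *)

(* Defs.v *)
From HB Require Import structures.
From mathcomp Require Import all_boot all_order all_algebra finmap.
From mathcomp Require Import all_classical all_reals all_analysis.
Import Order.TTheory GRing.Theory Num.Theory.
Import numFieldNormedType.Exports.

Set Implicit Arguments.
Unset Strict Implicit.
Unset Printing Implicit Defensive.

Local Open Scope classical_set_scope.
Local Open Scope ring_scope.

(* Total versions of min and max on sets of naturals: they return 0 when the
   minimum (maximum) does not exist. *)
Definition nat_min (A : set nat) : nat :=
  xget 0%N [set n | A n /\ forall m, A m -> (n <= m)%N].
Definition nat_max (A : set nat) : nat :=
  xget 0%N [set n | A n /\ forall m, A m -> (m <= n)%N].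

Definition generates (G : groupType) (S : set G) : Prop :=
  forall H : {pred G}, group_closed H -> (forall s, S s -> s \in H) ->
  forall x, x \in H.

Section FreeProduct.
Variables (I : choiceType) (G : I -> groupType).

Definition letter := {i : I & G i}.
Implicit Types (a b : letter) (u v w : seq letter).

Definition reduced w :=
  all (fun a => tagged a != 1%g) w && sorted (fun a b => tag a != tag b) w.

Record free_product := FreeProduct { word :> seq letter; _ : reduced word }.

HB.instance Definition _ := [isSub for word].
HB.instance Definition _ := [Choice of free_product by <:].

(* The reduced form of the word [a :: w], for [w] reduced. *)
Definition lcons a w : seq letter :=
  if tagged a == 1%g then w else
  if w is b :: w' then
    if tag a == tag b then
      let c := (tagged a * tagged_as a b)%g in
      if c == 1%g then w' else Tagged (fun i => G i) c :: w'
    else a :: w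
  else [:: a].

Definition linv a : letter := Tagged (fun i => G i) (tagged a)^-1%g.

Lemma reduced_cons a w : reduced (a :: w) =
  [&& tagged a != 1%g, (if w is b :: _ then tag a != tag b else true)
    & reduced w].
Proof.
rewrite /reduced /=; case: w => [|b w] /=; first by rewrite !andbT.
by case: (tagged a != _); case: (tagged b != _); case: (all _ _); case: (tag a != _).
Qed.

Lemma lcons_reduced a w : reduced w -> reduced (lcons a w).
Proof.
rewrite /lcons; case: ifPn => // a1; case: w => [|b w].
  by move=> _; rewrite reduced_cons a1.
case: ifPn => [ab|ab] rbw; last by rewrite reduced_cons a1 ab.
move: rbw; rewrite reduced_cons => /and3P[_ hb rw] /=.
case: ifPn => // c1; rewrite reduced_cons c1 rw andbT /=.
by case: w hb {rw} => // d w; rewrite (eqP ab).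
Qed.

Lemma lcons_id a w : reduced (a :: w) -> lcons a w = a :: w.
Proof.
rewrite reduced_cons /lcons => /and3P[/negbTE-> + _].
by case: w => // b w /negbTE->.
Qed.

Lemma lcons1 i w : lcons (Tagged (fun i => G i) (1%g : G i)) w = w.
Proof. by rewrite /lcons eqxx. Qed.

Lemma lconsM i (x y : G i) w : reduced w ->
  lcons (Tagged (fun i => G i) (x * y)%g) w =
  lcons (Tagged (fun i => G i) x) (lcons (Tagged (fun i => G i) y) w).
Proof.
move=> rw; have [->|x1] := eqVneq x 1%g; first by rewrite mul1g lcons1.
have [->|y1] := eqVneq y 1%g; first by rewrite mulg1 lcons1.
case: w rw => [|[j z] w] rw; rewrite /lcons /= (negbTE x1) (negbTE y1).
  by rewrite /= eqxx tagged_asE.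
have [eij|nij] := eqVneq i j; last first.
  by rewrite /= eqxx tagged_asE.
subst j; rewrite !tagged_asE; move: rw.
rewrite reduced_cons /= => /and3P[z1 hw rw].
have [yz|yz] := eqVneq (y * z)%g 1%g.
  have -> : (x * y * z)%g = x by rewrite -mulgA yz mulg1.
  rewrite (negbTE x1).
  have zE : z = (y^-1)%g by rewrite -[z](mulKg y) yz mulg1.
  case: ifP => [/eqP xy1|xy1].
    have xz : x = z by rewrite zE -[x](mulgK y) xy1 mul1g.
    by case: w hw {rw} => [|b w /negbTE ->] //=; rewrite xz.
  by case: w hw {rw} => [|b w /negbTE ->].
rewrite /= eqxx tagged_asE !mulgA.
by case: ifP => [/eqP xy1|//]; rewrite xy1 mul1g (negbTE z1).
Qed.

Lemma lconsK a w : reduced w -> lcons (linv a) (lcons a w) = w.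
Proof. by case: a => i x rw; rewrite -lconsM ?mulVg ?lcons1. Qed.

Definition wmul u v := foldr lcons v u.
Definition winv u := rev (map linv u).

Lemma wmul_reduced u v : reduced v -> reduced (wmul u v).
Proof. by move=> rv; elim: u => //= a u IH; apply: lcons_reduced. Qed.

Lemma wmul_lcons a u v : reduced v -> reduced u ->
  wmul (lcons a u) v = lcons a (wmul u v).
Proof.
move=> rv ru; rewrite {1}/lcons; case: ifPn => [/eqP a1|a1].
  by case: a a1 => i x /= ->; rewrite lcons1.
case: u ru => //= b u ru; case: ifPn => //= ab.
case: a b ab a1 ru => i x [j y] /= /eqP eij x1 ru; subst j.
rewrite tagged_asE.
rewrite -lconsM ?wmul_reduced //; case: ifPn => [/eqP->|//].
by rewrite lcons1.
Qed.

Lemma wmulA u v w : reduced v -> reduced w ->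
  wmul u (wmul v w) = wmul (wmul u v) w.
Proof.
move=> rv rw; elim: u => //= a u ->.
by rewrite wmul_lcons // wmul_reduced.
Qed.

Lemma wmul1 u : reduced u -> wmul u [::] = u.
Proof.
elim: u => //= a u IH rau; rewrite IH ?lcons_id //.
by move: rau; rewrite reduced_cons => /and3P[].
Qed.

Lemma winvK : involutive winv.
Proof.
move=> u; rewrite /winv map_rev revK -map_comp map_id_in // => -[i x] _.
by rewrite /= /linv /= invgK.
Qed.

Lemma winv_reduced u : reduced u -> reduced (winv u).
Proof.
rewrite /reduced /winv all_rev rev_sorted all_map => /andP[u1 su].
apply/andP; split.
  by apply: sub_all u1 => -[i x] /=; rewrite /= invg_eq1.
by rewrite sorted_map; apply: sub_sorted su => -[i x] [j y] /=; rewrite eq_sym.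
Qed.

Lemma wmulV u : reduced u -> wmul (winv u) u = [::].
Proof.
elim: u => //= a u IH rau.
have ru : reduced u by move: rau; rewrite reduced_cons => /and3P[].
rewrite /winv /= rev_cons -cats1 /wmul foldr_cat /= -[a :: u]lcons_id //.
rewrite lconsK //; exact: IH.
Qed.

Definition fp_one : free_product := @FreeProduct [::] isT.
Definition fp_mul (x y : free_product) : free_product :=
  FreeProduct (wmul_reduced x (valP y)).
Definition fp_inv (x : free_product) : free_product :=
  FreeProduct (winv_reduced (valP x)).

Lemma fp_mulA : associative fp_mul.
Proof. by move=> x y z; apply: val_inj; apply: wmulA; apply: valP. Qed.
Lemma fp_mul1g : left_id fp_one fp_mul.
Proof. by move=> x; apply: val_inj. Qed.
Lemma fp_mulg1 : right_id fp_one fp_mul.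
Proof. by move=> x; apply/val_inj/wmul1/valP. Qed.
Lemma fp_mulVg : left_inverse fp_one fp_inv fp_mul.
Proof. by move=> x; apply/val_inj/wmulV/valP. Qed.
Lemma fp_mulgV : right_inverse fp_one fp_inv fp_mul.
Proof.
move=> x; apply: val_inj => /=; rewrite -{1}[word x]winvK.
exact/wmulV/winv_reduced/valP.
Qed.

HB.instance Definition _ := isGroup.Build free_product
  fp_mulA fp_mul1g fp_mulg1 fp_mulVg fp_mulgV.

(* The embedding of the factor [G i]; it sends the identity to the empty word. *)
Definition fp_inj (i : I) (x : G i) : free_product :=
  FreeProduct (lcons_reduced (Tagged (fun i => G i) x) (valP fp_one)).

Definition free_gens (S : forall i, set (G i)) : set free_product :=
  \bigcup_i (@fp_inj i @` S i).

Definition infinite_word (x : nat -> letter) : Prop :=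
  forall n, tagged (x n) != 1%g /\ tag (x n) != tag (x n.+1).

End FreeProduct.

Definition cayley (G : groupType) (S : set G) : rel G :=
  fun x y => `[< exists2 s, S s & y = (x * s)%g >].

Section Ends.
Variables (V : choiceType) (adj : rel V).

Definition graph_dist (x y : V) : nat :=
  nat_min [set n | exists p, [/\ path adj x p, last x p = y & size p = n]].

Definition is_ray (f : nat -> V) : Prop :=
  injective f /\ forall n, adj (f n) (f n.+1).

Definition ray_equiv (f g : nat -> V) : Prop :=
  exists h, [/\ is_ray h, infinite_set (range h `&` range f)
              & infinite_set (range h `&` range g)].

Definition is_end : set (set (nat -> V)) :=
  [set w | exists2 f, is_ray f & w = [set g | is_ray g /\ ray_equiv f g]].

Definition graph_end := {w : set (nat -> V) | is_end w}.

Definition in_end (f : nat -> V) (w : graph_end) : Prop := sval w f.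

Definition connected_in (A : set V) (x y : V) : Prop :=
  exists p, [/\ path adj x p, last x p = y & forall z, z \in x :: p -> A z].

Definition is_component (A C : set V) : Prop :=
  exists2 x, A x & C = [set y | connected_in A x y].

Definition is_end_component (w : graph_end) (F C : set V) : Prop :=
  is_component (~` F) C /\
  forall f, in_end f w -> finite_set (range f `\` C).

Variable o : V.

(* This is B_(m-1), including B_(-1) = set0. *)
Definition open_ball (m : nat) : set V := [set x | (graph_dist o x < m)%N].

Definition confluent (w1 w2 : graph_end) : nat :=
  nat_max [set m | exists C, is_end_component w1 (open_ball m) C /\
                             is_end_component w2 (open_ball m) C].

Definition end_dist (R : realType) (alpha : R) (w1 w2 : graph_end) : R :=
  if `[< w1 = w2 >] then 0 else alpha ^+ confluent w1 w2.

End Ends.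

Section Dimensions.
Variables (R : realType) (T : Type) (d : T -> T -> R).
Local Open Scope ereal_scope.

Definition cball (c : T) (e : R) : set T := [set x | (d c x <= e)%R].

(* A finite or countable family of balls is indexed by a subset [D] of nat. *)
Definition is_cover (A : set T) (D : set nat) (c : nat -> T) (e : nat -> R) :=
  (forall i, D i -> A (c i) /\ (0 < e i)%R) /\
  A `<=` \bigcup_(i in D) cball (c i) (e i).

(* It is +oo when no finite cover exists. *)
Definition covering_number (A : set T) (e : R) : \bar R :=
  ereal_inf [set n%:R%:E | n in [set n : nat | exists c rad,
    is_cover A `I_n c rad /\ forall i, (i < n)%N -> (rad i <= e)%R]].

Definition box_ratio (A : set T) (e : R) : \bar R :=
  lne (covering_number A e) / (- ln e)%:E.

Definition lower_box_dim (A : set T) : \bar R :=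
  limf_einf (box_ratio A) 0^'+.
Definition upper_box_dim (A : set T) : \bar R :=
  limf_esup (box_ratio A) 0^'+.

Definition has_box_dim (A : set T) (v : \bar R) : Prop :=
  lower_box_dim A = v /\ upper_box_dim A = v.

Definition hausdorff_pre (A : set T) (del e : R) : \bar R :=
  ereal_inf [set x | exists D c rad,
    [/\ is_cover A D c rad, forall i, D i -> (rad i < e)%R
      & x = \esum_(i in D) (rad i `^ del)%:E]].

Definition hausdorff_measure (A : set T) (del : R) : \bar R :=
  lim (hausdorff_pre A del e @[e --> 0^'+]).

Definition hausdorff_dim (A : set T) : \bar R :=
  ereal_inf [set del%:E | del in
    [set del : R | (0 <= del)%R /\ hausdorff_measure A del = 0]].

End Dimensions.

Section FreeProductEnds.
Variables (I : finType) (G : I -> groupType) (S : forall i, set (G i)).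

Definition fp_cayley : rel (free_product G) := cayley (free_gens S).

Definition fp_length (x : free_product G) : nat := graph_dist fp_cayley 1%g x.

Definition fp_end := graph_end fp_cayley.

(* An infinite word is identified with the end containing a ray that runs
   through all its finite prefixes. *)
Definition describes (x : nat -> letter G) (w : fp_end) : Prop :=
  exists2 f, in_end f w & forall n, exists k, word (f k) = mkseq x n.

Definition Omega : set fp_end := setT.

Definition Omega_infty : set fp_end :=
  [set w | exists2 x, infinite_word x & describes x w].

Definition fp_end_dist (R : realType) (alpha : R) : fp_end -> fp_end -> R :=
  end_dist (1%g : free_product G) alpha.

Definition sphere_card (i : I) (m : nat) : nat :=
  #|` fset_set [set x : G i | fp_length (fp_inj x) = m]|.

Variable R : realType.

Definition growth_series (i : I) (z : R) : \bar R :=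
  (\sum_(1 <= m <oo) ((sphere_card i m)%:R * z ^+ m)%:E)%E.

Definition growth_solution (z : R) : Prop :=
  [/\ 0 < z, forall i, (growth_series i z < +oo)%E
    & \sum_(i : I) fine (growth_series i z) / (1 + fine (growth_series i z))
      = 1].

Definition smallest_growth_solution (z : R) : Prop :=
  growth_solution z /\ forall z', growth_solution z' -> z <= z'.

End FreeProductEnds.

Arguments fp_end_dist {I G} S {R} alpha.
Arguments Omega {I G} S _.
Arguments Omega_infty {I G} S _.

(* Main.v *)
(* A closed ball of radius alpha^m in the space of ends is the set of ends lying
   in one component of the complement of B_(m-1). Each such component meets the
   sphere of radius m, and the length in the free product is additive over the
   letters of a reduced word; with y_i = S_i^+(z) / (1 + S_i^+(z)), induction on
   words shows that at most C y_i z^(-m) elements of length m start in the i-th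
   factor, because the y_i sum to 1. This bounds the upper box-counting dimension
   and, through covers by balls of equal radii, the Hausdorff dimension.

   For the lower bounds let delta < log z / log alpha, so that
   t = alpha^delta > z. For some K the series truncated to letters of length at
   most K already satisfy sum_i y_i >= 1 at t, and the weight
   t^(l(x_1 ... x_n)) (1 - y_(type of x_n)) of a word is at most the total weight
   of its one-letter extensions. A ball of radius about alpha^m only meets infinite
   words with short letters in a cylinder over a prefix of length at least m - K,
   since every prefix is a cut vertex. A cover with small sum of radii^delta would
   therefore miss some infinite word, built letter by letter.

   The solution z exists because each growth sequence is submultiplicative, so
   that its series diverges at its radius of convergence. *)

Require Import Defs.
From mathcomp Require Import all_boot all_order all_algebra finmap.
From mathcomp Require Import all_classical all_reals all_analysis.
From mathcomp Require Import ring lra.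
Import Order.TTheory GRing.Theory Num.Theory.
Import numFieldNormedType.Exports.

Set Implicit Arguments.
Unset Strict Implicit.
Unset Printing Implicit Defensive.

Local Open Scope classical_set_scope.
Local Open Scope ring_scope.

(** * Ends of a locally finite graph *)

Lemma nat_min_spec (A : set nat) n : A n ->
  A (nat_min A) /\ forall m, A m -> (nat_min A <= m)%N.
Proof.
move=> An; rewrite /nat_min; case: xgetP => [m _ //|] /(_ _) H.
have exA : exists m, `[< A m >] by exists n; apply/asboolP.
case: (ex_minnP exA) => m /asboolP Am mm; case: (H m); split => // k /asboolP.
exact: mm.
Qed.

Lemma nat_max_spec (A : set nat) n M : A n -> (forall m, A m -> (m <= M)%N) ->
  A (nat_max A) /\ forall m, A m -> (m <= nat_max A)%N.
Proof.
move=> An bA; rewrite /nat_max; case: xgetP => [m _ //|] /(_ _) H.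
have exA : exists m, `[< A m >] by exists n; apply/asboolP.
have bA' m : `[< A m >] -> (m <= M)%N by move/asboolP/bA.
case: (ex_maxnP exA bA') => m /asboolP Am mm; case: (H m); split => // k /asboolP.
exact: mm.
Qed.


Lemma inj_leaves_finite (T : Type) (f : nat -> T) (F : set T) :
  injective f -> finite_set F -> exists N, forall j, (N <= j)%N -> ~ F (f j).
Proof.
move=> fI finF.
have /finite_seqP[s fs] : finite_set (f @^-1` F).
  by apply: finite_preimage => // ? ? _ _; exact: fI.
exists (\max_(i <- s) i).+1 => j Nj Fj.
have js : j \in s by have : (f @^-1` F) j by []; rewrite fs.
by move: Nj; rewrite ltnNge (leq_bigmax_seq j).
Qed.

Lemma inj_infinite_range (T : Type) (f : nat -> T) (F : set T) :
  injective f -> (forall N, exists2 j, (N <= j)%N & F (f j)) ->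
  infinite_set (range f `&` F).
Proof.
move=> fI H finF; have [N HN] := inj_leaves_finite fI finF.
by have [j Nj Fj] := H N; apply: HN Nj _; split => //; exists j.
Qed.

Lemma infinite_range_meet (T : Type) (f g : nat -> T) :
  infinite_set (range f `&` range g) ->
  forall N, exists a b, [/\ (N <= a)%N, (N <= b)%N & f a = g b].
Proof.
move=> infE N; apply: contrapT => H; apply: infE.
apply: (@sub_finite_set _ _ ((f @` `I_N) `|` (g @` `I_N))); last first.
  by rewrite finite_setU; split; apply: finite_image; exact: finite_II.
move=> x [[a _ fa] [b _ gb]].
have [aN|Na] := ltnP a N; first by left; exists a.
have [bN|Nb] := ltnP b N; first by right; exists b.
by case: H; exists a, b; split => //; rewrite fa gb.
Qed.

Section Graph.
Local Open Scope nat_scope.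
Variables (V : choiceType) (adj : rel V) (o : V).
Hypothesis adjC : symmetric adj.

Implicit Types (A : set V) (f g h : nat -> V) (x y z : V) (p q : seq V).

Lemma connected_in_refl A x : A x -> connected_in adj A x x.
Proof. by move=> Ax; exists [::]; split => // z; rewrite inE => /eqP->. Qed.

Lemma connected_inW A x y : connected_in adj A x y -> A x /\ A y.
Proof.
case=> p [_ <- H]; split; first by apply: H; rewrite mem_head.
by apply: H; exact: mem_last.
Qed.

Lemma connected_in_trans A y x z :
  connected_in adj A x y -> connected_in adj A y z -> connected_in adj A x z.
Proof.
case=> p [pp lp Ap] [q [pq lq Aq]]; exists (p ++ q).
rewrite cat_path pp last_cat lp; split => // t; rewrite -cat_cons mem_cat.
by case/orP => [/Ap //|tq]; apply: Aq; rewrite inE tq orbT.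
Qed.

Lemma connected_in_sym A x y : connected_in adj A x y -> connected_in adj A y x.
Proof.
case=> p [pp lp Ap]; exists (rev (belast x p)); split.
- by rewrite -lp rev_path; under eq_path do rewrite adjC.
- by case: p lp {pp Ap} => //= a p _; rewrite rev_cons last_rcons.
- move=> z; rewrite -lp -rev_rcons -lastI mem_rev; exact: Ap.
Qed.

Lemma connected_in_sub A B x y : A `<=` B ->
  connected_in adj A x y -> connected_in adj B x y.
Proof. by move=> AB [p [pp lp Ap]]; exists p; split => // z /Ap /AB. Qed.

Lemma connected_in_adj A x y : A x -> A y -> adj x y -> connected_in adj A x y.
Proof.
move=> Ax Ay xy; exists [:: y]; rewrite /= xy; split => // z.
by rewrite !inE => /orP[]/eqP->.
Qed.

Lemma ray_connected A f j k : is_ray adj f -> (j <= k) ->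
  (forall i, j <= i -> A (f i)) -> connected_in adj A (f j) (f k).
Proof.
move=> [_ fa] jk Af; rewrite -(subnKC jk); elim: (k - j) => [|n IH].
  by rewrite addn0; apply: connected_in_refl; apply: Af.
apply: connected_in_trans IH _; rewrite addnS; apply: connected_in_adj => //.
  by apply: Af; rewrite leq_addr.
by apply: Af; rewrite -addnS leq_addr.
Qed.

(* The tails of [f] and [g] lie in the same component of [A]. *)
Definition same_tail A f g :=
  exists N, forall j k, N <= j -> N <= k -> connected_in adj A (f j) (g k).

Lemma same_tailC A f g : same_tail A f g -> same_tail A g f.
Proof.
by case=> N H; exists N => j k Nj Nk; apply: connected_in_sym; exact: H.
Qed.

Lemma same_tail_trans A g f h :
  same_tail A f g -> same_tail A g h -> same_tail A f h.
Proof.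
move=> [N H] [M K]; exists (maxn N M) => j k; rewrite !geq_max.
case/andP=> Nj Mj /andP[Nk Mk].
by apply: (@connected_in_trans _ (g (maxn N M))); [apply: H|apply: K] => //;
  rewrite (leq_maxl, leq_maxr).
Qed.

Lemma same_tail_sub A B f g : A `<=` B -> same_tail A f g -> same_tail B f g.
Proof.
move=> AB [N H]; exists N => j k Nj Nk.
by apply: connected_in_sub (H _ _ Nj Nk).
Qed.

(** Each path properly extends the previous one, so [P i] has more than [i] vertices and its entry
    at index [i] is final. These entries form the limit ray. *)
Lemma nested_paths_ray (P : nat -> seq V) :
  (forall n, uniq (P n) /\ sorted adj (P n)) -> 0 < size (P 0) ->
  (forall n, exists2 q, P n.+1 = P n ++ q & 0 < size q) ->
  exists2 h, is_ray adj h &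
    forall n x0 i, i < size (P n) -> nth x0 (P n) i = h i.
Proof.
move=> PP P0 PS.
have szP n : n < size (P n).
  elim: n => // n IH; have [q -> q0] := PS n; rewrite size_cat.
  by rewrite -addn1 leq_add.
have PE m n x0 i : m <= n -> i < size (P m) -> nth x0 (P n) i = nth x0 (P m) i.
  move=> /subnKC<- im; elim: (n - m) => [|k IH]; first by rewrite addn0.
  rewrite addnS; have [q -> _] := PS (m + k).
  rewrite nth_cat ifT // (leq_trans im) //.
  elim: (k) => [|l IH']; first by rewrite addn0.
  rewrite addnS; have [q' -> _] := PS (m + l).
  by rewrite size_cat (leq_trans IH') // leq_addr.
have hE n x0 i : i < size (P n) -> nth x0 (P n) i = nth o (P i) i.
  move=> ilt; rewrite (set_nth_default o) //.
  by case: (leqP n i) => [/PE->//|/ltnW/PE->//].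
exists (fun i => nth o (P i) i) => //; split => [i j /eqP|n]; last first.
  rewrite -(hE n.+1 o n); last by rewrite ltnW.
  by have [_ /sortedP] := PP n.+1; apply; exact: szP.
wlog ij : i j / i <= j => [H|].
  by case/orP: (leq_total i j) => [/H//|/H]; rewrite eq_sym => /[apply].
have ilt : i < size (P j) by apply: leq_ltn_trans ij (szP j).
by rewrite -(hE j o i) // nth_uniq ?szP // => [/eqP//|]; case: (PP j).
Qed.

(** * Distances from the root and separation of ends by balls *)

Hypothesis reach : forall x, exists2 p, path adj o p & last o p = x.
Hypothesis finite_balls : forall m, finite_set (open_ball adj o m).

Local Notation dist := (graph_dist adj o).
Local Notation far m := (~` open_ball adj o m).

Lemma geodesic x : exists p, [/\ path adj o p, last o p = x & size p = dist x].
Proof.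
have [p pp lp] := reach x.
by case: (@nat_min_spec [set n | exists p,
  [/\ path adj o p, last o p = x & size p = n]] (size p)) => //; exists p.
Qed.

Lemma dist_path p : path adj o p -> dist (last o p) <= size p.
Proof.
move=> pp; case: (@nat_min_spec [set n | exists q,
  [/\ path adj o q, last o q = last o p & size q = n]] (size p)).
  by exists p.
by move=> _; apply; exists p.
Qed.

Lemma dist_adj x y : adj x y -> dist y <= (dist x).+1.
Proof.
have [p [pp lp <-]] := geodesic x => xy.
rewrite -(size_rcons p y) -{1}(last_rcons o p y).
by apply: dist_path; rewrite rcons_path pp lp.
Qed.

Lemma dist_root : dist o = 0.
Proof. by apply/eqP; rewrite -leqn0; apply: (@dist_path [::]). Qed.

Lemma dist_eq0 x : dist x = 0 -> x = o.
Proof. by have [p [_ <- <-]] := geodesic x; case: p. Qed.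

Lemma dist_pred x k : dist x = k.+1 -> exists2 y, adj y x & dist y = k.
Proof.
have [p [pp lp sp]] := geodesic x; rewrite -sp.
case/lastP: p pp lp sp => // p z; rewrite rcons_path last_rcons size_rcons.
move=> /andP[pp pz] zx sx [sk]; subst z; exists (last o p) => //.
rewrite -sk; apply/eqP; rewrite eqn_leq dist_path //=.
by have := dist_adj pz; rewrite -sx ltnS.
Qed.

Lemma far_sphere m x : m <= dist x ->
  exists2 y, dist y = m & connected_in adj (far m) y x.
Proof.
move=> mx; have [k kE] : {k | dist x = m + k} by exists (dist x - m); rewrite subnKC.
elim: k x kE {mx} => [|k IH] x kE.
  exists x; first by rewrite kE addn0.
  by apply: connected_in_refl; rewrite /open_ball /= kE addn0 ltnn.
have [z zx dz] := @dist_pred x (m + k) (etrans kE (addnS _ _)).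
have [y dy yz] := IH z dz; exists y => //.
apply: connected_in_trans yz _; apply: connected_in_adj => //;
  by rewrite /open_ball /= ?dz ?kE; apply/negP; rewrite -leqNgt leq_addr.
Qed.

Lemma far_le m n : m <= n -> far n `<=` far m.
Proof. by move=> mn x /=; apply: contra_not => /leq_trans; apply. Qed.

Lemma ray_far m f : is_ray adj f -> exists N, forall j, N <= j -> far m (f j).
Proof. by case=> fI _; exact: inj_leaves_finite. Qed.

Lemma same_tail_refl m f : is_ray adj f -> same_tail (far m) f f.
Proof.
move=> rf; have [N HN] := ray_far m rf; exists N => j k Nj Nk.
case/orP: (leq_total j k) => [jk|kj].
  by apply: ray_connected => // i ji; apply: HN; exact: leq_trans ji.
apply: connected_in_sym; apply: ray_connected => // i ji; apply: HN.
exact: leq_trans ji.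
Qed.

(* A finite piece of the connecting ray under construction: it ends on [f], and
   [f] does not return to it. *)
Definition stub f p :=
  [/\ uniq p, sorted adj p &
    exists k, [/\ 0 < size p, forall x0, last x0 p = f k
                & forall j, k < j -> f j \notin p]].

(** The extension follows [f], which never returns to [p], until it is outside a ball containing
    [p], and crosses to [g] there. Hence it avoids [p] throughout. *)
Lemma stub_step f g p : is_ray adj f -> is_ray adj g ->
  (forall m, same_tail (far m) f g) -> stub f p ->
  exists2 q, 0 < size q & stub g (p ++ q).
Proof.
move=> rf rg fg [up sp [k [p0 lp fp]]].
have [m pm] : exists m, forall x, x \in p -> dist x < m.
  exists (\max_(x <- p) dist x).+1 => x xp.
  by rewrite ltnS (leq_bigmax_seq x).
pose B := [set x | x \notin p].
have farB : far m `<=` B.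
  by move=> x fx; apply/negP => /pm; exact: fx.
have [N HN] := fg m.
have [N1 k1] := (leq_maxl N k.+1, leq_maxr N k.+1).
have : connected_in adj B (f k.+1) (g N).
  apply: (@connected_in_trans _ (f (maxn N k.+1))).
    by apply: ray_connected => // i; exact: fp.
  by apply: connected_in_sub (HN _ _ N1 (leqnn _)).
case=> q [pq lq Bq].
(* Stopping at the largest index [l] reached on [g] keeps the rest of [g] free. *)
have exl : exists l, g l \in f k.+1 :: q.
  by exists N; rewrite -lq mem_last.
have bnd : exists b, forall l, g l \in f k.+1 :: q -> l <= b.
  have [b Hb] := inj_leaves_finite rg.1 (finite_seq (f k.+1 :: q)).
  by exists b => l lin; rewrite leqNgt; apply/negP => /ltnW /Hb; exact.
case: bnd => b bnd; case: (ex_maxnP exl bnd) => l lin lmax.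
have Nl : N <= l by apply: lmax; rewrite -lq mem_last.
case/splitPl: lin pq lq Bq lmax {exl bnd} => q1 q2 lq1.
rewrite cat_path => /andP[pq1 _] _ Bq lmax.
(* Removing loops adds no vertices, so the new piece still avoids [p] and the part of [g] beyond
   index [l]. *)
case/shortenP: pq1 lq1 => q' pq' uq' sub lq'.
have sub' z : z \in f k.+1 :: q' -> z \in f k.+1 :: q1 ++ q2.
  by rewrite !inE mem_cat => /orP[->//|/sub->]; rewrite orbT.
exists (f k.+1 :: q') => //; split.
- rewrite cat_uniq up uq' andbT; apply/negP => /hasP[z /sub'/Bq].
  by rewrite /B /= => /negP + zp; apply.
- case: p p0 sp lp {up fp pm B farB Bq} => // x p _ /= sp lp.
  rewrite cat_path sp /= pq' andbT (lp x).
  by case: rf => _; exact.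
- exists l; split => [|x0|j lj].
  + by rewrite size_cat addnS.
  + by rewrite last_cat.
  + rewrite mem_cat negb_or; apply/andP; split.
      apply: farB.
      by have [] := connected_inW (HN N j (leqnn _) (leq_trans Nl (ltnW lj))).
    by apply/negP => /sub'/lmax; rewrite leqNgt lj.
Qed.

(** Extending stubs alternately towards [f] and [g] gives in the limit a ray that meets both
    infinitely often. *)
Lemma same_tail_ray_equiv f g : is_ray adj f -> is_ray adj g ->
  (forall m, same_tail (far m) f g) -> ray_equiv adj f g.
Proof.
move=> rf rg fg.
(* The boolean tells on which of the two rays the current stub ends. *)
pose fb (b : bool) := if b then f else g.
have rfb b : is_ray adj (fb b) by case: b.
have st b m : same_tail (far m) (fb b) (fb (~~ b)).
  by case: b => //=; apply: same_tailC.
pose T := {bp : bool * seq V | stub (fb bp.1) bp.2}.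
pose Rel (s t : T) := (sval t).1 = ~~ (sval s).1 /\
  exists2 q, (sval t).2 = (sval s).2 ++ q & 0 < size q.
have step (s : T) : {t | Rel s t}.
  case: s => -[b p] sp; apply: cid.
  have [q q0 sq] := stub_step (rfb b) (rfb (~~ b)) (st b) sp.
  by exists (exist _ (~~ b, p ++ q) sq); split => //; exists q.
have s0 : stub (fb true) [:: f 0].
  split => //; exists 0; split => // j j0; rewrite inE.
  by apply/eqP => /(rf.1) jj; rewrite jj in j0.
have [F [F0 FS]] := dependent_choice step (exist _ (true, [:: f 0]) s0).
pose P n := (sval (F n)).2.
have PP n : stub (fb (sval (F n)).1) (P n) by exact: (svalP (F n)).
have bE n : (sval (F n)).1 = ~~ odd n.
  by elim: n => [|n IH]; [rewrite F0|rewrite (FS n).1 IH].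
have [||n|h rh hP] := @nested_paths_ray P.
- by move=> n; case: (PP n).
- by rewrite /P F0.
- by have [_ [q ? ?]] := FS n; exists q.
have szP n : n < size (P n).
  elim: n => [|n IH]; first by rewrite /P F0.
  by have [_ [q E q0]] := FS n; rewrite /P E size_cat -addn1 leq_add.
have key b : infinite_set (range h `&` range (fb b)).
  apply: inj_infinite_range rh.1 _ => N.
  have [n Nn nb] : exists2 n, N <= n & ~~ odd n = b.
    have [|ne] := eqVneq (~~ odd N) b; first by exists N.
    by exists N.+1 => //=; case: (odd N) b ne => -[].
  have [_ _ [k [p0 lp _]]] := PP n.
  exists (size (P n)).-1; first by rewrite -ltnS prednK // (leq_trans _ (szP n)).
  exists k => //; rewrite -(hP n o) ?prednK // nth_last (lp o).
  by rewrite bE nb.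
by exists h; split => //; [exact: (key true)|exact: (key false)].
Qed.

(** The intermediate ray meets each of the two rays arbitrarily late, and at such a vertex the tails
    are joined. *)
Lemma ray_equiv_same_tail f g m : is_ray adj f -> is_ray adj g ->
  ray_equiv adj f g -> same_tail (far m) f g.
Proof.
move=> rf rg [h [rh hf hg]].
have key k : is_ray adj k -> infinite_set (range h `&` range k) ->
    same_tail (far m) h k.
  move=> rk hk.
  have [N HN] := same_tail_refl m rh; have [M HM] := same_tail_refl m rk.
  exists (maxn N M) => i j; rewrite !geq_max => /andP[Ni Mi] /andP[Nj Mj].
  have [a [b [+ + ab]]] := infinite_range_meet hk (maxn N M).
  rewrite !geq_max => /andP[Na Ma] /andP[Nb Mb].
  apply: connected_in_trans (HN i a Ni Na) _; rewrite ab; exact: HM.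
by apply: same_tail_trans (key g rg hg); apply: same_tailC; exact: key.
Qed.

Lemma ray_equivE f g : is_ray adj f -> is_ray adj g ->
  ray_equiv adj f g <-> forall m, same_tail (far m) f g.
Proof.
move=> rf rg; split => [fg m|]; last exact: same_tail_ray_equiv.
exact: ray_equiv_same_tail.
Qed.

Lemma end_ray (w : graph_end adj) f : in_end f w -> is_ray adj f.
Proof. by case: w => w [g rg wE]; rewrite /in_end /= wE => -[]. Qed.

Lemma in_endE (w : graph_end adj) f g : in_end f w ->
  in_end g w <-> is_ray adj g /\ forall m, same_tail (far m) f g.
Proof.
move=> fw; have rf := end_ray fw.
case: w fw => w [h rh wE]; rewrite /in_end /= wE => -[_ /(ray_equivE rh rf) hf].
split => [[rg /(ray_equivE rh rg) hg]|[rg fg]]; split => //.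
  by move=> m; apply: same_tail_trans (hg m); exact: same_tailC.
by apply/ray_equivE => // m; apply: same_tail_trans (fg m).
Qed.

Lemma end_of_ray f : is_ray adj f -> exists w : graph_end adj, in_end f w.
Proof.
move=> rf.
have wP : is_end adj [set g | is_ray adj g /\ ray_equiv adj f g] by exists f.
exists (exist _ _ wP); split => //.
by apply/ray_equivE => // m; exact: same_tail_refl.
Qed.

Lemma end_nonempty (w : graph_end adj) : exists f, in_end f w.
Proof.
case: w => w [f rf wE]; exists f; rewrite /in_end /= wE; split => //.
by apply/ray_equivE => // m; exact: same_tail_refl.
Qed.

Lemma end_eq (w1 w2 : graph_end adj) f g : in_end f w1 -> in_end g w2 ->
  (forall m, same_tail (far m) f g) -> w1 = w2.
Proof.
move=> fw gw fg; have gw1 : in_end g w1.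
  by apply/(in_endE _ fw); split => //; exact: end_ray gw.
suff : sval w1 = sval w2 by apply: eq_sig_hprop => *; exact: Prop_irrelevance.
apply/seteqP; split=> h.
  by move=> /(in_endE _ gw1) /(in_endE _ gw).
by move=> /(in_endE _ gw) /(in_endE _ gw1).
Qed.

Lemma end_component_tail (w : graph_end adj) m C f : in_end f w ->
  is_end_component w (open_ball adj o m) C ->
  exists N, forall j, N <= j -> C (f j).
Proof.
move=> fw [_ /(_ f fw) finC].
have [N HN] := inj_leaves_finite (end_ray fw).1 finC.
by exists N => j /HN H; apply: contrapT => nC; apply: H; split => //; exists j.
Qed.

Lemma common_componentE (w1 w2 : graph_end adj) f g m :
  in_end f w1 -> in_end g w2 ->
  (exists C, is_end_component w1 (open_ball adj o m) C /\
             is_end_component w2 (open_ball adj o m) C) <->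
  same_tail (far m) f g.
Proof.
move=> fw gw; split.
  case=> C [C1 C2].
  have [N HN] := end_component_tail fw C1.
  have [M HM] := end_component_tail gw C2.
  case: C1 => -[x _ CE] _; rewrite CE in HN HM.
  exists (maxn N M) => j k; rewrite !geq_max => /andP[Nj _] /andP[_ Mk].
  apply: connected_in_trans (HM _ Mk).
  by apply: connected_in_sym; exact: HN.
move=> fg; have [N HN] := same_tail_refl m (end_ray fw).
pose C := [set y | connected_in adj (far m) (f N) y].
have comp : is_component adj (far m) C.
  exists (f N) => //.
  by have [] := connected_inW (HN N N (leqnn _) (leqnn _)).
have key (w : graph_end adj) h : in_end h w -> same_tail (far m) f h ->
    is_end_component w (open_ball adj o m) C.
  move=> hw fh; split; first exact: comp.
  move=> k /(in_endE _ hw)[rk /(_ m) hk].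
  have [M HM] := same_tail_trans fh hk.
  apply: (@sub_finite_set _ _ (k @` `I_M)); last first.
    by apply: finite_image; exact: finite_II.
  move=> _ [[j _ <-] nC]; exists j => //=; rewrite ltnNge; apply/negP => Mj.
  apply: nC; apply: connected_in_trans (HN _ (maxn N M) _ (leq_maxl _ _)) _ => //.
  by apply: HM => //; exact: leq_maxr.
exists C; split; first exact: key fw (same_tail_refl _ (end_ray fw)).
exact: key gw fg.
Qed.

(** Here [nat_max] is a true maximum: the admissible radii contain 0 because the graph is connected,
    and they are bounded because distinct ends are separated by some ball. They are also closed
    downwards. *)
Lemma confluentE (w1 w2 : graph_end adj) f g m : w1 <> w2 ->
  in_end f w1 -> in_end g w2 ->
  m <= confluent o w1 w2 <-> same_tail (far m) f g.
Proof.
move=> w12 fw gw; rewrite /confluent.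
have E n : (exists C, is_end_component w1 (open_ball adj o n) C /\
  is_end_component w2 (open_ball adj o n) C) = same_tail (far n) f g.
  by apply/propext; exact: common_componentE.
under eq_set do rewrite E.
have [M HM] : exists M, forall n, same_tail (far n) f g -> n <= M.
  apply: contrapT => H; apply: w12; apply: (end_eq fw gw) => n.
  apply: contrapT => nn; apply: H; exists n => k.
  by apply: contraPleq => /ltnW /far_le /same_tail_sub kn /kn.
have g0 : same_tail (far 0) f g.
  have conn x : connected_in adj (far 0) o x.
    have [p pp lp] := reach x; exists p; split => //.
  exists 0 => j k _ _; apply: connected_in_trans (conn _).
  exact: connected_in_sym.
have [/= cm cmax] := nat_max_spec (A := [set n | same_tail (far n) f g]) g0 HM.
split => [mc|]; last exact: cmax.
by apply: same_tail_sub cm; exact: far_le.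
Qed.

Lemma end_dist_le (R : realType) (alpha : R) (w1 w2 : graph_end adj) f g m :
  (0 < alpha < 1)%R -> in_end f w1 -> in_end g w2 ->
  (end_dist o alpha w1 w2 <= alpha ^+ m)%R <-> same_tail (far m) f g.
Proof.
move=> /andP[a0 a1] fw gw; rewrite /end_dist; case: asboolP => [ww|w12].
  split => _; last by rewrite exprn_ge0 // ltW.
  by rewrite -ww in gw; have /(in_endE _ fw)[_] := gw; exact.
by rewrite ler_iXn2l //; exact: confluentE.
Qed.

Lemma end_dist_lt (R : realType) (alpha : R) (w1 w2 : graph_end adj) f g m :
  (0 < alpha < 1)%R -> in_end f w1 -> in_end g w2 ->
  (end_dist o alpha w1 w2 < alpha ^+ m)%R -> same_tail (far m) f g.
Proof. by move=> a01 fw gw /ltW /(end_dist_le m a01 fw gw). Qed.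

(** Lets the vertices of the sphere of radius [m] index the balls of a cover. *)
Lemma end_sphere (w : graph_end adj) f m : in_end f w ->
  exists2 y, dist y = m &
    exists N, forall j, N <= j -> connected_in adj (far m) y (f j).
Proof.
move=> fw; have [N HN] := same_tail_refl m (end_ray fw).
have [_ /negP] := connected_inW (HN N N (leqnn _) (leqnn _)).
rewrite -leqNgt => /far_sphere[y dy yN]; exists y => //; exists N => j Nj.
by apply: connected_in_trans yN _; exact: HN.
Qed.

End Graph.

(** * Word length in a group *)

Section WordLength.
Local Open Scope nat_scope.
Local Open Scope group_scope.
Variables (G : groupType) (S : set G).
Hypothesis symS : forall s, S s -> S (s^-1).

Definition reachable (x : G) :=
  exists2 p, path (cayley S) 1 p & last 1 p = x.

Definition word_length (x : G) : nat := graph_dist (cayley S) 1 x.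

Lemma cayleyC : symmetric (cayley S).
Proof.
by move=> x y; apply/asboolP/asboolP => -[s Ss ->]; exists s^-1;
  rewrite ?mulgK //; exact: symS.
Qed.

Lemma cayleyMl g x y : cayley S (g * x) (g * y) = cayley S x y.
Proof.
apply/asboolP/asboolP => -[s Ss E]; exists s => //.
  by apply: (mulgI g); rewrite mulgA.
by rewrite E mulgA.
Qed.

Lemma path_mull g x p :
  path (cayley S) (g * x) (map (fun y => g * y) p) = path (cayley S) x p.
Proof. by elim: p x => //= y p IH x; rewrite cayleyMl IH. Qed.

Lemma reachable1 : reachable 1. Proof. by exists [::]. Qed.

Lemma reachable_gen s : S s -> reachable s.
Proof.
by move=> Ss; exists [:: s] => //=; rewrite andbT; apply/asboolP; exists s;
  rewrite ?mul1g.
Qed.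

Lemma path_mul p q : path (cayley S) 1 p -> path (cayley S) 1 q ->
  let r := p ++ map (fun y => last 1 p * y) q in
  [/\ path (cayley S) 1 r, last 1 r = last 1 p * last 1 q
    & size r = (size p + size q)%N].
Proof.
move=> pp pq; split; last by rewrite size_cat size_map.
  by rewrite cat_path pp -[X in path _ X]mulg1 path_mull.
by rewrite last_cat -[X in last X _]mulg1 last_map.
Qed.

Lemma reachableM x y : reachable x -> reachable y -> reachable (x * y).
Proof.
move=> [p pp <-] [q pq <-]; have [pr lr _] := path_mul pp pq.
by exists (p ++ map (fun y => last 1 p * y) q).
Qed.

Lemma path_inv p : path (cayley S) 1 p -> exists q,
  [/\ path (cayley S) 1 q, last 1 q = (last 1 p)^-1 & size q = size p].
Proof.
move=> pp; exists (map (fun y => (last 1 p)^-1 * y) (rev (belast 1 p))).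
rewrite -[X in path _ X](mulVg (last 1 p)) path_mull rev_path.
split.
- by under eq_path do rewrite cayleyC.
- rewrite -[X in last X _](mulVg (last 1 p)) last_map.
  by case: p pp => [|a p _] /=; rewrite ?mulg1 // rev_cons last_rcons mulg1.
- by rewrite size_map size_rev size_belast.
Qed.

Lemma reachableV x : reachable x -> reachable x^-1.
Proof. by case=> p pp <-; have [q [pq lq _]] := path_inv pp; exists q. Qed.

(** The reachable elements form a subgroup containing [S]; conversely, a walk from 1 stays inside
    every subgroup containing [S]. *)
Lemma generates_reachable : generates S <-> forall x, reachable x.
Proof.
split=> [gS x|rS H Hc SH x].
  suff : x \in [pred y | `[< reachable y >]] by move=> /asboolP; apply.
  apply: gS => [|s Ss]; last by apply/asboolP; exact: reachable_gen.
  split; first by apply/asboolP; exact: reachable1.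
  move=> y z /asboolP ry /asboolP rz; apply/asboolP.
  by apply: reachableM => //; exact: reachableV.
have [p pp <-] := rS x.
elim/last_ind: p pp => [_|p y IH]; first by case: Hc.
rewrite rcons_path last_rcons => /andP[/IH Hp /asboolP[s Ss ->]].
by apply: group_closedM => //; exact: SH.
Qed.

Hypothesis reachS : forall x, reachable x.

Lemma word_lengthP x : exists p,
  [/\ path (cayley S) 1 p, last 1 p = x & size p = word_length x].
Proof. exact: geodesic. Qed.

Lemma word_length_path p : path (cayley S) 1 p ->
  (word_length (last 1 p)%g <= size p)%N.
Proof. exact: dist_path. Qed.

Lemma word_length1 : word_length 1 = 0%N.
Proof. exact: dist_root. Qed.

Lemma word_length_eq0 x : (word_length x == 0%N) = (x == 1).
Proof.
apply/eqP/eqP => [|->]; last exact: word_length1.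
exact: dist_eq0.
Qed.

Lemma word_lengthM x y : (word_length (x * y)%g <= word_length x + word_length y)%N.
Proof.
have [p [pp <- <-]] := word_lengthP x; have [q [pq <- <-]] := word_lengthP y.
have [pr <- <-] := path_mul pp pq; exact: word_length_path.
Qed.

Lemma word_lengthV x : word_length x^-1 = word_length x.
Proof.
have H y : (word_length y^-1%g <= word_length y)%N.
  have [p [pp <- <-]] := word_lengthP y; have [q [pq <- <-]] := path_inv pp.
  exact: word_length_path.
by apply/eqP; rewrite eqn_leq H -{1}[x]invgK H.
Qed.

Lemma word_length_gen s : S s -> (word_length s <= 1)%N.
Proof.
move=> Ss; apply: (@word_length_path [:: s]) => /=; rewrite andbT.
by apply/asboolP; exists s; rewrite ?mul1g.
Qed.

Lemma word_length_pred x k : word_length x = k.+1 ->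
  exists y s, [/\ S s, x = y * s & word_length y = k].
Proof.
by move=> /(dist_pred reachS)[y /asboolP[s Ss ->] yk]; exists y, s.
Qed.

(** A geodesic is cut; subadditivity of the length then forces the second part to have exactly the
    prescribed length. *)
Lemma word_length_split x m n : word_length x = (m + n)%N ->
  exists y z, [/\ x = y * z, word_length y = m & word_length z = n].
Proof.
elim: n x => [|n IH] x; first by exists x, 1; rewrite mulg1 word_length1 -[m]addn0.
rewrite addnS => xmn; have [y [s [Ss xE ymn]]] := word_length_pred xmn.
have [u [v [yE um vn]]] := IH y ymn.
exists u, (v * s); split => //; first by rewrite mulgA -yE.
apply/eqP; rewrite eqn_leq; apply/andP; split.
  by rewrite (leq_trans (word_lengthM _ _)) // vn -addn1 leq_add2l word_length_gen.
have := word_lengthM u (v * s); rewrite mulgA -yE -xE xmn um.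
by rewrite -addnS leq_add2l.
Qed.

Hypothesis finS : finite_set S.

Lemma finite_word_ball m : finite_set [set x | (word_length x < m)%N].
Proof.
elim: m => [|m IH].
  by apply: (@sub_finite_set _ _ set0) => // x /=; rewrite ltn0.
apply: (@sub_finite_set _ _ ([set 1] `|`
  [set y * s | y in [set x | (word_length x < m)%N] & s in S])).
  move=> x; rewrite /= ltnS; case E : (word_length x) => [|k] km.
    by left; move/eqP: E; rewrite word_length_eq0 => /eqP.
  right; have [y [s [Ss xE yk]]] := word_length_pred E.
  by exists y; [rewrite /= yk|exists s].
by rewrite finite_setU; split; [exact: finite_set1|exact: finite_image2].
Qed.

End WordLength.

(** * Words and rays in a free product *)

Lemma geodesic_uniq (V : choiceType) (adj : rel V) (o : V) p :
  path adj o p -> size p = graph_dist adj o (last o p) -> uniq (o :: p).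
Proof.
move=> pp; case: (shortenP pp) => p' pp' up' sub sp.
apply: (leq_size_uniq up').
  by move=> z; rewrite !inE => /orP[->//|/sub->]; rewrite orbT.
by rewrite /= ltnS sp; exact: dist_path.
Qed.

Section FreeProduct.
Local Open Scope nat_scope.
Variables (I : finType) (G : I -> groupType) (S : forall i, set (G i)).
Arguments S : clear implicits.
Hypothesis symS : forall i s, S i s -> S i (s^-1)%g.
Hypothesis reachS : forall i x, reachable (S i) x.
Hypothesis finS : forall i, finite_set (S i).

Local Notation L i x := (@Tagged I i (fun j => G j) x).
Local Notation gens := (free_gens S).
Local Notation adj := (fp_cayley S).
Local Notation len := (fp_length S).

Implicit Types (x y : free_product G) (u v w : seq (letter G)).

Lemma fp_injE i (g : G i) x : word (fp_inj g * x)%g = lcons (L i g) x.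
Proof. by apply: (@wmul_lcons _ _ _ [::]); [exact: valP|]. Qed.

Lemma fp_injM i (g h : G i) : fp_inj (g * h)%g = (fp_inj g * fp_inj h)%g.
Proof. by apply: val_inj; rewrite [RHS]fp_injE /= lconsM. Qed.

Lemma fp_inj1 i : fp_inj (1%g : G i) = 1%g.
Proof. by apply: val_inj; rewrite /= /lcons eqxx. Qed.

Lemma fp_injV i (g : G i) : fp_inj (g^-1)%g = ((fp_inj g)^-1)%g.
Proof. by apply: (mulgI (fp_inj g)); rewrite -fp_injM !mulgV fp_inj1. Qed.

Lemma fp_ind (P : free_product G -> Prop) : P 1%g ->
  (forall i (g : G i) x, reduced (L i g :: x) -> P x -> P (fp_inj g * x)%g) ->
  forall x, P x.
Proof.
move=> P1 PM [w rw]; elim: w rw => [|[i g] w IH] rw.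
  by have -> : FreeProduct rw = 1%g by exact: val_inj.
have rw' : reduced w by move: (rw); rewrite reduced_cons => /and3P[].
have -> : FreeProduct rw = (fp_inj g * FreeProduct rw')%g.
  by apply: val_inj; rewrite [RHS]fp_injE lcons_id.
by apply: PM => //; exact: IH.
Qed.

Lemma free_gens_sym x : gens x -> gens (x^-1)%g.
Proof.
case=> i _ [s Ss <-]; exists i => //; exists (s^-1)%g; first exact: symS.
by rewrite fp_injV.
Qed.

Lemma reachable_inj i (g : G i) : reachable gens (fp_inj g).
Proof.
have [p pp <-] := reachS g.
elim/last_ind: p pp => [_|p y IH].
  by rewrite fp_inj1; exact: reachable1.
rewrite rcons_path last_rcons => /andP[/IH Hp /asboolP[s Ss ->]].
rewrite fp_injM; apply: reachableM => //; apply: reachable_gen.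
by exists i => //; exists s.
Qed.

Lemma reachable_fp x : reachable gens x.
Proof.
elim/fp_ind: x => [|i g x _ IH]; first exact: reachable1.
by apply: reachableM => //; exact: reachable_inj.
Qed.

Lemma finite_free_gens : finite_set gens.
Proof.
by apply: bigcup_finite => [|i _]; [exact: finite_finset|exact: finite_image].
Qed.

Lemma finite_fp_ball m : finite_set (open_ball adj 1%g m).
Proof.
apply: finite_word_ball; [exact: reachable_fp|exact: finite_free_gens].
Qed.

Definition letter_len (a : letter G) := word_length (S (tag a)) (tagged a).
Definition wlen w := \sum_(a <- w) letter_len a.

Lemma wlen_cons a w : wlen (a :: w) = letter_len a + wlen w.
Proof. exact: big_cons. Qed.

Lemma wlen_cat u v : wlen (u ++ v) = wlen u + wlen v.
Proof. exact: big_cat. Qed.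

Lemma wlen_rcons w a : wlen (rcons w a) = wlen w + letter_len a.
Proof. by rewrite -cats1 wlen_cat /wlen big_seq1. Qed.

Lemma wlen_winv w : wlen (winv w) = wlen w.
Proof.
rewrite /wlen /winv (perm_big _ (permEl (perm_rev _))) big_map.
by apply: eq_bigr => -[i g] _; rewrite /letter_len /= word_lengthV //; exact: symS.
Qed.

Lemma wlen_lcons a w : wlen (lcons a w) <= letter_len a + wlen w.
Proof.
rewrite /lcons; case: ifP => _; first exact: leq_addl.
case: w => [|b w]; first by rewrite wlen_cons.
case: ifP => [/eqP ab|_]; last by rewrite wlen_cons.
rewrite [wlen (b :: w)]wlen_cons addnA; case: ifP => _; first exact: leq_addl.
rewrite wlen_cons leq_add2r.
case: a b ab => i g [j h] /= ij; subst j; rewrite tagged_asE.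
exact: word_lengthM.
Qed.

Lemma len_inj_le i (g : G i) : len (fp_inj g) <= word_length (S i) g.
Proof.
move E : (word_length _ _) => k; elim: k g E => [|k IH] g.
  move=> /eqP; rewrite word_length_eq0 // => /eqP->.
  by rewrite fp_inj1 /fp_length dist_root.
move=> /(word_length_pred (@reachS i))[h [s [Ss -> hk]]].
rewrite fp_injM -addn1; apply: leq_trans (@word_lengthM _ gens _ _ _) _.
  exact: reachable_fp.
apply: leq_add; first exact: IH.
by apply: word_length_gen; exists i => //; exists s.
Qed.

(** Joining geodesics of the letters gives the upper bound. For the lower bound, a generator changes
    [wlen] by at most 1. *)
Lemma len_wlen x : len x = wlen x.
Proof.
apply/eqP; rewrite eqn_leq; apply/andP; split.
  elim/fp_ind: x => [|i g x rx IH].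
    by rewrite /fp_length dist_root.
  rewrite fp_injE lcons_id // wlen_cons.
  apply: leq_trans (@word_lengthM _ gens reachable_fp _ _) _.
  by apply: leq_add => //; exact: len_inj_le.
move E : (len x) => k; elim: k x E => [|k IH] x.
  by move=> /eqP; rewrite word_length_eq0 => [/eqP->|]; rewrite ?/wlen ?big_nil //;
    exact: reachable_fp.
move=> /(word_length_pred reachable_fp)[y [s [[i _ [g Sg <-]] -> yk]]].
(* Generators act on the right, [lcons] on the left; inversion exchanges the two sides and preserves
   [wlen]. *)
rewrite -wlen_winv -[winv _]/(word (y * fp_inj g)^-1%g) invgM -fp_injV fp_injE.
apply: leq_trans (wlen_lcons _ _) _; rewrite -add1n leq_add //.
  by rewrite /letter_len word_lengthV ?word_length_gen //; exact: symS.
by rewrite [wlen _]wlen_winv; exact: IH.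
Qed.

Lemma len_inj i (g : G i) : len (fp_inj g) = word_length (S i) g.
Proof.
rewrite len_wlen /= /lcons /=; case: eqP => [->|_].
  by rewrite /wlen big_nil word_length1.
by rewrite /wlen big_seq1.
Qed.

Lemma lcons_edge a w : exists w' p q,
  [/\ w = p ++ w', lcons a w = q ++ w', size p <= 1 & size q <= 1].
Proof.
rewrite /lcons; case: ifP => _; first by exists w, [::], [::].
case: w => [|b w]; first by exists [::], [::], [:: a].
case: ifP => ab; last by exists (b :: w), [::], [:: a].
case: ifP => c1; first by exists w, [:: b], [::].
by exists w, [:: b], [:: L (tag a) (tagged a * tagged_as a b)%g].
Qed.

Lemma adj_edge x y : adj x y -> exists w p q,
  [/\ word x = w ++ p, word y = w ++ q, size p <= 1 & size q <= 1].
Proof.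
move=> /asboolP[_ [i _ [s _ <-]] ->].
have [w [p [q [xE yE sp sq]]]] := lcons_edge (L i (s^-1)%g) (winv (word x)).
exists (winv w), (winv p), (winv q); split; rewrite ?size_rev ?size_map //.
  by rewrite -[word x]winvK xE /winv map_cat rev_cat.
rewrite -[word _]winvK -[winv (word _)]/(word (x * fp_inj s)^-1%g).
by rewrite invgM -fp_injV fp_injE yE /winv map_cat rev_cat.
Qed.

Definition strict_prefix u w := prefix u w && (size u < size w).

(** An edge changes at most the last letter, so from strictly beyond [u] it can leave only to [u]
    itself. *)
Lemma adj_strict_prefix u x y : adj x y -> strict_prefix u x ->
  word y <> u -> strict_prefix u y.
Proof.
move=> /adj_edge[w [p [q [-> -> p1 q1]]]] /andP[ux ltux] yu.
have uw : size u <= size w.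
  by rewrite -ltnS (leq_trans ltux) // size_cat -addn1 leq_add2l.
have {ux} uw' : prefix u w by move: ux; rewrite !prefixE takel_cat.
apply/andP; split; first exact: prefix_catl.
rewrite size_cat -(addn0 (size u)).
(* Either the common part [w] is longer than [u], or it equals [u] and a further letter must be
   present. *)
move: uw; rewrite leq_eqVlt => /orP[/eqP E|lt]; last by rewrite -addSn leq_add.
rewrite E ltn_add2l lt0n size_eq0; apply/eqP => q0; apply: yu.
by move: uw'; rewrite q0 cats0 prefixE E take_size => /eqP.
Qed.

(* [u] is a cut vertex: a path can leave the cone over [u] only through [u]. *)
Lemma path_strict_prefix u m x p : wlen u < m -> path adj x p ->
  (forall z, z \in x :: p -> ~ open_ball adj 1%g m z) ->
  strict_prefix u x -> strict_prefix u (last x p).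
Proof.
move=> um; elim: p x => //= y p IH x /andP[xy pp] far ux.
apply: IH => //; first by move=> z zp; apply: far; rewrite inE zp orbT.
apply: adj_strict_prefix xy ux _ => yu.
apply: (far y); first by rewrite !inE eqxx orbT.
by rewrite /open_ball /= -[graph_dist _ _ _]/(len y) len_wlen yu.
Qed.

Definition runs_along (f : nat -> free_product G) (xi : nat -> letter G) :=
  forall n, exists k, word (f k) = mkseq xi n.

(** The prefixes are distinct vertices, so the indices at which they occur are distinct and leave
    every initial segment. *)
Lemma runs_along_far f xi N n : runs_along f xi ->
  exists j n', [/\ N <= j, n <= n' & word (f j) = mkseq xi n'].
Proof.
move=> /choice[k kE].
have kI : injective k.
  by move=> a b ab; rewrite -(size_mkseq xi a) -kE ab kE size_mkseq.
have [M HM] := inj_leaves_finite kI (finite_II N).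
exists (k (maxn n M)), (maxn n M); split => //; last exact: leq_maxl.
by rewrite leqNgt; apply/negP; apply: HM; exact: leq_maxr.
Qed.

Lemma take_mkseq (T : Type) (f : nat -> T) n m : n <= m ->
  take n (mkseq f m) = mkseq f n.
Proof. by move=> nm; rewrite /mkseq -map_take take_iota (minn_idPl nm). Qed.

(** A late vertex of [f] lies strictly beyond the prefix of [xi]. The connecting path cannot cross
    that prefix, which lies in the ball, so it ends at a vertex of [g] beyond the same prefix. *)
Lemma same_tail_prefix f g xi eta m n : runs_along f xi -> runs_along g eta ->
  same_tail adj (~` open_ball adj 1%g m) f g -> wlen (mkseq xi n) < m ->
  mkseq xi n = mkseq eta n.
Proof.
move=> fxi geta [N HN] um.
have [j [a [Nj na fj]]] := runs_along_far N n.+1 fxi.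
have [k [b [Nk nb gk]]] := runs_along_far N n.+1 geta.
have [p [pp lp Ap]] := HN j k Nj Nk.
have := path_strict_prefix um pp Ap; rewrite lp /strict_prefix fj gk !prefixE.
rewrite !size_mkseq na take_mkseq; last exact: ltnW.
rewrite eqxx => /(_ isT) /andP[/eqP <- _].
by rewrite take_mkseq // ltnW.
Qed.

Lemma mkseq_reduced (xi : nat -> letter G) n : infinite_word xi -> reduced (mkseq xi n).
Proof.
move=> Hxi; apply/andP; split.
  by rewrite all_map; apply/allP => k _ /=; have [] := Hxi k.
rewrite sorted_map; case: n => // n; apply/(sortedP 0) => k.
rewrite size_iota => kn; rewrite !nth_iota // ?add0n; last exact: ltnW.
by have [] := Hxi k.
Qed.

(** Geodesics for the successive letters are strung together. Additivity of the length makes every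
    finite stage a geodesic, hence free of repeated vertices. *)
Lemma word_ray (xi : nat -> letter G) : infinite_word xi ->
  exists2 f, is_ray adj f & runs_along f xi.
Proof.
move=> Hxi; pose pref n := FreeProduct (mkseq_reduced n Hxi).
pose xl n := fp_inj (tagged (xi n)).
have prefS n : pref n.+1 = (pref n * xl n)%g.
  apply: val_inj; rewrite /= -[LHS]wmul1 ?mkseq_reduced //.
  rewrite mkseqS -cats1 /wmul foldr_cat /= -[foldr _ _ _]/(wmul _ _).
  by congr wmul; rewrite /xl /=; case: (xi n).
have /choice[q qP] : forall n, exists q, [/\ path adj 1%g q, last 1%g q = xl n
    & size q = len (xl n)].
  by move=> n; exact: (word_lengthP reachable_fp).
pose fix p n := if n is k.+1 then p k ++ map (fun y => pref k * y)%g (q k)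
                else [::].
have pP n : [/\ path adj 1%g (p n), last 1%g (p n) = pref n
              & size (p n) = len (pref n)].
  elim: n => [|n [pp lp sp]].
    split => //; first exact: val_inj.
    by rewrite len_wlen /wlen big_nil.
  have [pq lq sq] := qP n.
  have [] := path_mul pp pq; rewrite -[cayley _]/adj lp lq -prefS => ? ? sE.
  split => //; rewrite [LHS]sE sp sq !len_wlen /= mkseqS wlen_rcons.
  congr (_ + _); rewrite /lcons.
  have [/negbTE/= h _] := Hxi n.
  by rewrite h /wlen big_seq1 /letter_len.
have [||n|f rf fP] := @nested_paths_ray _ adj 1%g (fun n => 1%g :: p n).
- move=> n; have [pp lp sp] := pP n; split => //.
  by apply: geodesic_uniq pp _; rewrite sp lp.
- by [].
- exists (map (fun y => pref n * y)%g (q n)) => //.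
  have [_ _ sq] := qP n; rewrite size_map sq lt0n /fp_length.
  rewrite -[graph_dist _ _ _]/(len _) word_length_eq0; last exact: reachable_fp.
  apply/eqP => /(congr1 (@word _ _)); rewrite /xl /= /lcons /=.
  by have [/negbTE-> _] := Hxi n.
- exists f => // n; exists (size (p n)).
  have [_ lp _] := pP n.
  by rewrite -(fP n 1%g) /= ?ltnS // -[nth _ _ _]/(nth 1%g (_ :: p n) (size (p n)))
    -last_nth lp.
Qed.

End FreeProduct.

(** * Growth series *)

Section Growth.
Variable R : realType.

(** The summand of the growth equation; on nonnegative reals it is increasing and concave, with
    values in [0, 1). *)
Definition phi (x : R) : R := x / (1 + x).

Lemma phiE x : 0 <= x -> phi x = 1 - (1 + x)^-1.
Proof. by move=> x0; rewrite /phi; field; rewrite gt_eqF //; lra. Qed.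

Lemma phi_ge0 x : 0 <= x -> 0 <= phi x.
Proof. by move=> x0; rewrite divr_ge0 //; lra. Qed.

Lemma phi_lt1 x : 0 <= x -> phi x < 1.
Proof. by move=> x0; rewrite phiE // ltrBlDr ltrDl invr_gt0; lra. Qed.

Lemma ler_phi x y : 0 <= x -> x <= y -> phi x <= phi y.
Proof.
move=> x0 xy; rewrite !phiE; [|lra|lra].
by rewrite lerB // lef_pV2 ?posrE; lra.
Qed.

Lemma ltr_phi x y : 0 <= x -> x < y -> phi x < phi y.
Proof.
move=> x0 xy; rewrite !phiE; [|lra|lra].
by rewrite ltrD2l ltrN2 ltf_pV2 ?posrE; lra.
Qed.

Lemma phiD_le x y : 0 <= x -> 0 <= y -> phi (x + y) <= phi x + y.
Proof.
move=> x0 y0; rewrite /phi mulrDl lerD //.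
  by rewrite ler_wpM2l // lef_pV2 ?posrE; lra.
by rewrite ler_pdivrMr; nra.
Qed.

Lemma phi_scale t x : 0 <= t <= 1 -> 0 <= x -> t * phi x <= phi (t * x).
Proof.
move=> /andP[t0 t1] x0; rewrite /phi mulrA ler_wpM2l ?mulr_ge0 //.
by rewrite lef_pV2 ?posrE; nra.
Qed.

Lemma convex_exprn (x y t : R) m : 0 <= x -> x <= y -> 0 <= t <= 1 ->
  ((1 - t) * x + t * y) ^+ m <= (1 - t) * x ^+ m + t * y ^+ m.
Proof.
move=> x0 xy /andP[t0 t1]; elim: m => [|m IH]; first by rewrite !expr0; lra.
have y0 : 0 <= y by lra.
have zm : 0 <= (1 - t) * x + t * y by rewrite addr_ge0 // mulr_ge0 //; lra.
rewrite exprS; apply: le_trans (ler_wpM2l zm IH) _.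
rewrite !exprS; have : x ^+ m <= y ^+ m by rewrite lerXn2r.
move: (x ^+ m) (y ^+ m) => u v uv.
(* This product is exactly the slack left by the induction step. *)
have : 0 <= t * (1 - t) * ((y - x) * (v - u)).
  by rewrite !mulr_ge0 //; lra.
lra.
Qed.

Lemma bernoulli (d : R) n : 0 <= d <= 1 -> 1 - n%:R * d <= (1 - d) ^+ n.
Proof.
move=> /andP[d0 d1]; elim: n => [|n IH]; first by rewrite mul0r expr0; lra.
rewrite exprS; apply: le_trans (ler_wpM2l _ IH); last lra.
have n0 : 0 <= n%:R :> R by [].
by rewrite -natr1; nra.
Qed.

Lemma finite_lower_bound (I : finType) (e : I -> R) :
  (forall i, 0 < e i) -> exists2 d, 0 < d & forall i, d <= e i.
Proof.
move=> e0; have s0 : 0 <= \sum_i (e i)^-1.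
  by apply: sumr_ge0 => i _; rewrite invr_ge0 ltW.
(* The 1 keeps this positive for an empty index type; the inverse of the bound dominates every
   [(e i)^-1]. *)
exists (1 + \sum_i (e i)^-1)^-1; first by rewrite invr_gt0; lra.
move=> i; rewrite -[leRHS]invrK lef_pV2 ?posrE ?invr_gt0 //; last lra.
rewrite (bigD1 i) //= in s0 *.
have : 0 <= \sum_(j | j != i) (e j)^-1 by apply: sumr_ge0 => j _; rewrite invr_ge0 ltW.
lra.
Qed.

(** * Truncated growth series and the smallest solution *)

Variables (I : finType) (a : I -> nat -> nat).

Definition psum i K (z : R) := \sum_(1 <= m < K.+1) (a i m)%:R * z ^+ m.

Definition gser i (z : R) : \bar R :=
  (\sum_(1 <= m <oo) ((a i m)%:R * z ^+ m)%:E)%E.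

Definition Fsum K z := \sum_i phi (psum i K z).

Lemma psum_ge0 i K z : 0 <= z -> 0 <= psum i K z.
Proof. by move=> z0; apply: sumr_ge0 => m _; rewrite mulr_ge0 ?exprn_ge0. Qed.

Lemma psumS i K z : psum i K.+1 z = psum i K z + (a i K.+1)%:R * z ^+ K.+1.
Proof. by rewrite /psum big_nat_recr. Qed.

Lemma psum_leK i K L z : 0 <= z -> (K <= L)%N -> psum i K z <= psum i L z.
Proof.
move=> z0 /subnKC <-; elim: (L - K)%N => [|n IH]; first by rewrite addn0.
rewrite addnS psumS; apply: le_trans IH _.
by rewrite lerDl mulr_ge0 ?exprn_ge0.
Qed.

Lemma psum_lez i K z z' : 0 <= z -> z <= z' -> psum i K z <= psum i K z'.
Proof.
move=> z0 zz; apply: ler_sum => m _; rewrite ler_wpM2l // lerXn2r //.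
by rewrite nnegrE (le_trans z0).
Qed.

Lemma psum_scale i K z t : 0 <= z -> 0 <= t <= 1 ->
  t ^+ K * psum i K z <= psum i K (t * z).
Proof.
move=> z0 /andP[t0 t1]; rewrite /psum mulr_sumr; rewrite !big_nat.
apply: ler_sum => m /andP[m0 mK]; rewrite mulrCA ler_wpM2l // exprMn.
by rewrite ler_wpM2r ?exprn_ge0 // ler_wiXn2l.
Qed.

Lemma psum_convex i K x y t : 0 <= x -> x <= y -> 0 <= t <= 1 ->
  psum i K ((1 - t) * x + t * y) <= (1 - t) * psum i K x + t * psum i K y.
Proof.
move=> x0 xy t01; rewrite /psum !mulr_sumr -big_split /=.
apply: ler_sum => m _.
have := @convex_exprn x y t m x0 xy t01.
have : 0 <= (a i m)%:R :> R by [].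
move=> am /(ler_wpM2l am); lra.
Qed.

Lemma Fsum_lez K z z' : 0 <= z -> z <= z' -> Fsum K z <= Fsum K z'.
Proof.
by move=> z0 zz; apply: ler_sum => i _; rewrite ler_phi ?psum_ge0 ?psum_lez.
Qed.

(** An explicit form of continuity: scaling [z] by [1 - d] costs at most the factor
    [(1 - d) ^+ K]. *)
Lemma Fsum_lower K z : 0 < z -> 1 < Fsum K z ->
  exists2 z', 0 <= z' < z & 1 < Fsum K z'.
Proof.
move=> z0 F1; set F := Fsum K z in F1.
(* With this [d], Bernoulli's inequality leaves at least [(1 - K d) F = 1 + d F], which exceeds
   1. *)
pose d := (F - 1) / (F * K.+1%:R).
have K0 : 0 < K.+1%:R :> R by [].
have d0 : 0 < d by rewrite divr_gt0 ?mulr_gt0 //; lra.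
have dE : F * (K.+1%:R * d) = F - 1.
  by rewrite /d; field; rewrite !gt_eqF //; lra.
have K1 : 1 <= K.+1%:R :> R by rewrite ler1n.
have d1 : d <= 1.
  have : d <= K.+1%:R * d by nra.
  have : K.+1%:R * d <= 1 by nra.
  lra.
exists ((1 - d) * z); first by apply/andP; split; nra.
have td : 0 <= 1 - d <= 1 by apply/andP; split; lra.
have tK : 0 <= (1 - d) ^+ K <= 1.
  by rewrite exprn_ge0 ?exprn_ile1 //; lra.
apply: (@lt_le_trans _ _ ((1 - d) ^+ K * F)).
  have : 1 - K%:R * d <= (1 - d) ^+ K by apply: bernoulli; apply/andP; split; lra.
  move: dE; rewrite -natr1; nra.
rewrite mulr_sumr; apply: ler_sum => i _.
apply: (le_trans (phi_scale tK _)); first exact/psum_ge0/ltW.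
apply: ler_phi; last by apply: psum_scale => //; exact: ltW.
by apply: mulr_ge0; [case/andP: tK|exact/psum_ge0/ltW].
Qed.

Lemma psum_le_gser i K z : 0 <= z -> ((psum i K z)%:E <= gser i z)%E.
Proof.
move=> z0; rewrite /psum -sumEFin; apply: nneseries_lim_ge => m _ _.
by rewrite lee_fin mulr_ge0 ?exprn_ge0.
Qed.

Lemma gser_le i z M : 0 <= z -> (forall K, psum i K z <= M) ->
  (gser i z <= M%:E)%E.
Proof.
move=> z0 HM; apply: lime_le.
  by apply: is_cvg_nneseries => m _ _; rewrite lee_fin mulr_ge0 ?exprn_ge0.
near=> n; rewrite sumEFin lee_fin.
have n0 : (0 < n)%N by near: n; exact: nbhs_infty_gt.
by have := HM n.-1; rewrite /psum prednK.
Unshelve. all: by end_near. Qed.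

Lemma gser_fin i z : 0 <= z -> (gser i z < +oo)%E ->
  (fine (gser i z))%:E = gser i z.
Proof.
move=> z0 fz; rewrite fineK // ge0_fin_numE //.
apply: le_trans (psum_le_gser i 0 z0).
by rewrite lee_fin psum_ge0.
Qed.

Lemma psum_le_fine i K z : 0 <= z -> (gser i z < +oo)%E ->
  psum i K z <= fine (gser i z).
Proof.
by move=> z0 fz; rewrite -lee_fin gser_fin //; exact: psum_le_gser.
Qed.

Lemma fine_gser_ge0 i z : 0 <= z -> (gser i z < +oo)%E -> 0 <= fine (gser i z).
Proof. by move=> z0 /(psum_le_fine 0 z0); apply: le_trans; exact: psum_ge0. Qed.

Lemma psum_approx i z e : 0 <= z -> (gser i z < +oo)%E -> 0 < e ->
  exists K, fine (gser i z) <= psum i K z + e.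
Proof.
move=> z0 fz e0; apply: contrapT => H.
have : (gser i z <= (fine (gser i z) - e)%:E)%E.
  apply: gser_le => // K; rewrite leNgt; apply/negP => lt; apply: H.
  by exists K; lra.
by rewrite -{1}gser_fin // lee_fin; lra.
Qed.

Definition Fser z := \sum_i phi (fine (gser i z)).

(** Finitely many series are approximated by one common truncation, with total error at most [e]. *)
Lemma Fser_le1 z : 0 <= z -> (forall i, gser i z < +oo)%E ->
  (forall K, Fsum K z <= 1) -> Fser z <= 1.
Proof.
move=> z0 fz F1; apply/ler_addgt0Pr => e e0.
pose e' := e / (#|I|%:R + 1).
have I0 : 0 <= #|I|%:R :> R by [].
have e'0 : 0 < e' by rewrite divr_gt0 //; lra.
have /choice[k kP] : forall i, exists K, fine (gser i z) <= psum i K z + e'.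
  by move=> i; exact: psum_approx.
have := F1 (\max_i k i)%N; set K := (\max_i k i)%N => FK.
apply: (@le_trans _ _ (\sum_i (phi (psum i K z) + e'))).
  apply: ler_sum => i _; apply: le_trans (phiD_le _ _); last 2 first.
  - exact: psum_ge0.
  - exact: ltW.
  apply: ler_phi; first exact: fine_gser_ge0.
  apply: le_trans (kP i) _; rewrite lerD2r; apply: psum_leK => //.
  exact: leq_bigmax.
rewrite big_split /= lerD // sumr_const -mulr_natl.
by rewrite /e' mulrA ler_pdivrMr; nra.
Qed.

Hypothesis a1 : forall i, (0 < a i 1)%N.
Hypothesis a_submul : forall i m n, (a i (m + n) <= a i m * a i n)%N.

(** The linear coefficient is at least 1, so the linear term alone accounts for the increase. *)
Lemma psum_diff i K z z' : 0 <= z -> z <= z' -> (0 < K)%N ->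
  psum i K z + (z' - z) <= psum i K z'.
Proof.
move=> z0 zz K0.
have E w : psum i K w =
    (a i 1)%:R * w + \sum_(2 <= m < K.+1) (a i m)%:R * w ^+ m.
  by rewrite /psum big_ltn ?ltnS // expr1.
rewrite !E.
have : \sum_(2 <= m < K.+1) (a i m)%:R * z ^+ m <=
       \sum_(2 <= m < K.+1) (a i m)%:R * z' ^+ m.
  apply: ler_sum => m _; rewrite ler_wpM2l // lerXn2r //.
  by rewrite nnegrE (le_trans z0).
have : 1 <= (a i 1)%:R :> R by rewrite ler1n.
nra.
Qed.

(* Submultiplicativity: one coefficient term less than 1 makes the series
   geometric, so the domain of convergence is open. *)
Lemma gser_extend i z : 0 <= z -> (gser i z < +oo)%E ->
  exists2 z1, z < z1 & (gser i z1 < +oo)%E.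
Proof.
move=> z0 fz.
(* Otherwise every term would be at least 1 and the partial sums would be unbounded. *)
have [m m0 am] : exists2 m, (0 < m)%N & (a i m)%:R * z ^+ m < 1.
  apply: contrapT => H.
  have psK K : K%:R <= psum i K z.
    elim: K => [|K IH]; first by rewrite psum_ge0.
    rewrite psumS -natr1 lerD // leNgt; apply/negP => lt; apply: H.
    by exists K.+1.
  have [K] : exists K, fine (gser i z) < K%:R.
    exists (Num.truncn (fine (gser i z))).+1; exact: truncnS_gt.
  by rewrite ltNge (le_trans (psK K)) // psum_le_fine.
have [z1 zz1 q1] : exists2 z1, z < z1 & (a i m)%:R * z1 ^+ m < 1.
  have : (fun x : R => (a i m)%:R * x ^+ m) @ z --> (a i m)%:R * z ^+ m.
    apply: cvgM; first exact: cvg_cst.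
    exact: exprn_continuous.
  move=> /cvgr_lt /(_ _ am) /nbhs_ballP[e /= e0 He].
  exists (z + e / 2); first by lra.
  apply: He; rewrite /ball /= opprD addNKr normrN gtr0_norm; lra.
exists z1 => //; have z10 : 0 <= z1 by lra.
set q := _ * _ in q1.
pose b n := (a i n)%:R * z1 ^+ n.
have b0 n : 0 <= b n by rewrite mulr_ge0 ?exprn_ge0.
have bM n : b (m + n)%N <= q * b n.
  rewrite /b exprD /q mulrACA ler_wpM2r ?mulr_ge0 ?exprn_ge0 //.
  by rewrite -natrM ler_nat.
(* The terms after index [m] are bounded by [q] times the series from its start; as [q < 1], this
   bounds all partial sums. *)
have key K : psum i K z1 <= psum i m z1 + q * psum i K z1.
  have q0 : 0 <= q by exact: b0.
  apply: (@le_trans _ _ (psum i (m + K) z1)).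
    by apply: psum_leK => //; exact: leq_addl.
  rewrite /psum (big_cat_nat (n := m.+1)) //=; last by rewrite ltnS leq_addr.
  rewrite lerD2l -(add1n m) big_addn -addnS addKn.
  rewrite mulr_sumr; apply: ler_sum => n _.
  by rewrite addnC; exact: bM.
apply: le_lt_trans (ltry (psum i m z1 / (1 - q))).
apply: gser_le => // K; rewrite ler_pdivlMr; last lra.
by have := key K; lra.
Qed.

(** By convexity each truncated series grows at most linearly between [z] and a larger point of
    convergence, with a slope independent of [K]. *)
Lemma Fsum_extend z : 0 <= z -> (forall i, gser i z < +oo)%E -> Fser z < 1 ->
  exists2 z', z < z' & forall K, Fsum K z' <= 1.
Proof.
move=> z0 fz Fz.
have /choice[y yP] : forall i, exists y, z < y /\ (gser i y < +oo)%E.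
  by move=> i; have [y ? ?] := gser_extend z0 (fz i); exists y.
pose g i := fine (gser i (y i)).
have g0 i : 0 <= g i.
  by have [zy fy] := yP i; apply: fine_gser_ge0 => //; lra.
pose c i := g i / (y i - z).
have c0 i : 0 <= c i by have [zy _] := yP i; rewrite divr_ge0 //; lra.
have [d d0 dP] : exists2 d, 0 < d & forall i, d <= y i - z.
  by apply: finite_lower_bound => i; have [zy _] := yP i; lra.
pose C := 1 + \sum_i c i.
have C1 : 1 <= C by rewrite lerDl sumr_ge0.
(* This [h] keeps [z + h] from passing any [y i], and the total increase within [1 - Fser z]. *)
pose h := Num.min d ((1 - Fser z) / C).
have h0 : 0 < h by rewrite lt_min d0 divr_gt0 //; lra.
have hd : h <= d by rewrite ge_min lexx.
have hC : h * C <= 1 - Fser z.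
  by rewrite -ler_pdivlMr ?ge_min ?lexx ?orbT //; lra.
exists (z + h) => [|K]; first lra.
have psb i : psum i K (z + h) <= fine (gser i z) + h * c i.
  have [zy fy] := yP i; have dy := dP i.
  pose t := h / (y i - z).
  have t01 : 0 <= t <= 1.
    by rewrite divr_ge0 //= ?ler_pdivrMr ?mul1r; lra.
  have -> : z + h = (1 - t) * z + t * y i.
    by rewrite /t; field; rewrite gt_eqF //; lra.
  apply: le_trans (psum_convex _ _ _ _ t01) _ => //; first lra.
  have -> : h * c i = t * g i by rewrite /c /t; ring.
  have p1 := psum_le_fine K z0 (fz i).
  have p2 : psum i K (y i) <= g i by apply: psum_le_fine => //; lra.
  have p3 := psum_ge0 i K z0.
  move/andP: t01 => [t0 t1]; nra.
apply: (@le_trans _ _ (\sum_i (phi (fine (gser i z)) + h * c i))).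
  apply: ler_sum => i _; have h1 : 0 <= h * c i by rewrite mulr_ge0 // ltW.
  apply: le_trans (phiD_le _ h1); last exact: fine_gser_ge0.
  by apply: ler_phi (psb i); rewrite psum_ge0 //; lra.
rewrite big_split /= -mulr_sumr -/(Fser z).
by move: hC; rewrite /C; lra.
Qed.

Hypothesis I2 : forall i : I, exists j, j != i.
Hypothesis I1 : exists i : I, True.

(** A second factor contributes at least [c = phi z], so [phi] of the partial sum is at most
    [1 - c], which bounds the partial sum by [c^-1]. *)
Lemma gser_finite z i : 0 < z -> (forall K, Fsum K z <= 1) -> (gser i z < +oo)%E.
Proof.
move=> z0 F1; have [j ji] := I2 i; have zz := ltW z0.
pose c := phi z.
have c0 : 0 < c by rewrite divr_gt0 //; lra.
apply: le_lt_trans (ltry (psum i 1 z + c^-1)).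
apply: gser_le => // -[|K].
  rewrite {1}/psum big_geq // addr_ge0 ?psum_ge0 ?invr_ge0 ?(ltW c0) //.
have : phi (psum i K.+1 z) + c <= 1.
  apply: le_trans (F1 K.+1); rewrite /Fsum (bigD1 i) //= (bigD1 j) //= addrA.
  rewrite -[leLHS]addr0 lerD //; last first.
    by apply: sumr_ge0 => k _; rewrite phi_ge0 ?psum_ge0.
  rewrite lerD2l; apply: ler_phi => //.
  have := @psum_diff j K.+1 0 z (lexx _) zz isT.
  have := @psum_ge0 j K.+1 0 (lexx _); lra.
have p0 := psum_ge0 i K.+1 zz; have q0 := psum_ge0 i 1 zz.
rewrite phiE // => H.
have : c <= (1 + psum i K.+1 z)^-1 by lra.
rewrite -[c in c <= _]invrK lef_pV2 ?posrE ?invr_gt0 //; lra.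
Qed.

(** The solution is the supremum of the points where all truncated sums are at most 1. The supremum
    is itself such a point by [Fsum_lower], and a full sum below 1 would allow a larger point by
    [Fsum_extend]. *)
Theorem growth_solution_exists : (exists K, 1 < Fsum K 1) ->
  exists z, [/\ 0 < z < 1, forall i, (gser i z < +oo)%E, Fser z = 1,
    forall z', 0 < z' -> (forall i, gser i z' < +oo)%E -> Fser z' = 1 -> z <= z'
    & forall z', z < z' -> exists K, 1 < Fsum K z'].
Proof.
case=> K0 FK0; have [y1 /andP[y10 y11] Fy1] := Fsum_lower ltr01 FK0.
pose A := [set z | 0 <= z /\ forall K, Fsum K z <= 1].
have psum0 i K : psum i K 0 = 0.
  rewrite /psum big_nat big1 // => m /andP[m0 _].
  by rewrite expr0n gtn_eqF // mulr0.
have A0 : A 0.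
  split => // K; rewrite /Fsum big1 // => i _.
  by rewrite psum0 /phi mul0r.
have Aub z : A z -> z <= y1.
  move=> [z0 /(_ K0)]; rewrite !leNgt; apply: contraNN => lt.
  by apply: lt_le_trans Fy1 _; apply: Fsum_lez => //; exact: ltW.
have hsA : has_sup A by split; [exists 0|exists y1].
pose z := sup A.
have zge x : A x -> x <= z by move=> Ax; apply: ub_le_sup => //; exists y1.
have z0 : 0 <= z by exact: zge.
have zy1 : z <= y1 by apply: ge_sup => //; exists 0.
have FK K : Fsum K z <= 1.
  rewrite leNgt; apply/negP => F1.
  have zpos : 0 < z.
    rewrite lt_def z0 andbT; apply/eqP => zE.
    by move: F1; rewrite zE; case: A0 => _ /(_ K); lra.
  have [w /andP[w0 wz] Fw] := Fsum_lower zpos F1.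
  suff : z <= w by lra.
  apply: ge_sup; first by exists 0.
  move=> x [x0 /(_ K)]; rewrite !leNgt; apply: contraNN => lt.
  by apply: lt_le_trans Fw _; apply: Fsum_lez => //; exact: ltW.
have fz i : (gser i z < +oo)%E.
  have [zE|zN] := eqVneq z 0.
    rewrite zE; apply: le_lt_trans (ltry 0); apply: gser_le => // K.
    by rewrite psum0.
  by apply: gser_finite => //; rewrite lt_def zN.
have above z' : z < z' -> exists K, 1 < Fsum K z'.
  move=> zz'; apply: contrapT => H.
  suff : A z' by move=> /zge; lra.
  split=> [|K]; first lra.
  by rewrite leNgt; apply/negP => lt; apply: H; exists K.
have Fz : Fser z = 1.
  apply/eqP; rewrite eq_le Fser_le1 //= leNgt; apply/negP => F1.
  have [z' zz' Fz'] := Fsum_extend z0 fz F1.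
  by have [K] := above z' zz'; have := Fz' K; lra.
exists z; split => //.
- apply/andP; split; last lra.
  rewrite lt_def z0 andbT; apply/eqP => zE.
  move: Fz; rewrite zE /Fser big1 => [/eqP|i _]; first by rewrite eq_sym oner_eq0.
  have -> : fine (gser i 0) = 0; last by rewrite /phi mul0r.
  apply/eqP; rewrite eq_le fine_gser_ge0 -?zE // andbT.
  rewrite -lee_fin gser_fin ?zE // -?zE //; apply: gser_le => // K.
  by rewrite zE psum0.
(* At a smaller [z'] every series is lower by at least [z - z'], so the sum would be strictly below
   1. *)
- move=> z' z'0 fz' Fz'; rewrite leNgt; apply/negP => lt.
  have z'0' := ltW z'0.
  have Gi i : fine (gser i z') < fine (gser i z).
    apply: (@lt_le_trans _ _ (fine (gser i z') + (z - z'))); first lra.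
    rewrite -lerBrDr -lee_fin gser_fin //; apply: gser_le => // -[|K].
      have := @psum_diff i 1 z' z z'0' (ltW lt) isT.
      have := psum_le_fine 1 z0 (fz i).
      by have := @psum_leK i 0 1 z' z'0' isT; lra.
    have := @psum_diff i K.+1 z' z z'0' (ltW lt) isT.
    by have := psum_le_fine K.+1 z0 (fz i); lra.
  have : Fser z' < Fser z.
    case: I1 => i0 _; rewrite /Fser (bigD1 i0) // [ltRHS](bigD1 i0) //=.
    apply: ltr_leD; first by apply: ltr_phi => //; exact: fine_gser_ge0.
    apply: ler_sum => i _; apply: ler_phi; first exact: fine_gser_ge0.
    exact: ltW.
  by rewrite Fz Fz' ltxx.
Qed.

End Growth.

(** * Dimensions from covers *)

Section Dim.
Variable R : realType.

Lemma exprn_small (q e : R) : 0 <= q < 1 -> 0 < e ->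
  exists N, forall n, (N <= n)%N -> q ^+ n < e.
Proof.
move=> /andP[q0 q1] e0; have : `|q| < 1 by rewrite ger0_norm.
by move=> /cvg_expr /cvgr_lt /(_ e e0) [N _ HN]; exists N => n; exact: HN.
Qed.

Lemma expr_bracket (q e : R) : 0 < q < 1 -> 0 < e < 1 ->
  exists m, q ^+ m.+1 <= e < q ^+ m.
Proof.
move=> /andP[q0 q1] /andP[e0 e1].
have [|N HN] := @exprn_small q e _ e0; first by rewrite ltW.
have exq : exists n, q ^+ n <= e by exists N; exact/ltW/HN.
case: (ex_minnP exq) => -[|m] qm mmin; first by move: qm; rewrite expr0; lra.
exists m; rewrite qm ltNge; apply/negP => /mmin; by rewrite ltnn.
Qed.

Lemma limf_einf_ge (f : R -> \bar R) (v : R) :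
  (forall w, w < v -> exists2 e0, 0 < e0 &
    forall e, 0 < e < e0 -> (w%:E <= f e)%E) ->
  (v%:E <= limf_einf f 0^'+)%E.
Proof.
move=> H; apply/lee_subgt0Pr => h h0.
have [|e0 e00 He] := H (v - h); first lra.
rewrite limf_einfE; apply: le_ereal_sup_tmp.
exists (ereal_inf (f @` [set e | 0 < e < e0])).
  exists [set e | 0 < e < e0] => //.
  by near=> e => /=; apply/andP; split; near: e; [exact: nbhs_right_gt|exact: nbhs_right_lt].
by apply: le_ereal_inf_tmp => _ [e /= /He eP <-]; rewrite -EFinB.
Unshelve. all: by end_near. Qed.

Lemma limf_esup_le (f : R -> \bar R) (v : R) :
  (forall w, v < w -> exists2 e0, 0 < e0 &
    forall e, 0 < e < e0 -> (f e <= w%:E)%E) ->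
  (limf_esup f 0^'+ <= v%:E)%E.
Proof.
move=> H; rewrite -leeN2 -limf_einfN -EFinN; apply: limf_einf_ge => w wv.
have [|e0 e00 He] := H (- w); first lra.
by exists e0 => // e /He; rewrite -leeN2 EFinN oppeK.
Qed.

Lemma limf_einf_le_esup (f : R -> \bar R) :
  (limf_einf f 0^'+ <= limf_esup f 0^'+)%E.
Proof.
rewrite limf_einfE limf_esupE; apply: ge_ereal_sup => _ [V FV <-].
apply: le_ereal_inf_tmp => _ [W FW <-].
have [x [Vx Wx]] := filter_ex (filterI FV FW).
apply: (@le_trans _ _ (f x)).
  by apply: ereal_inf_lbound; exists x.
by apply: ereal_sup_ubound; exists x.
Qed.

(** Makes multiplicative constants in covering bounds negligible in the box ratio. *)
Lemma neg_ln_large (k h : R) : 0 < h -> exists2 e0, 0 < e0 < 1 &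
  forall e, 0 < e < e0 -> 0 < - ln e /\ k <= h * (- ln e).
Proof.
move=> h0; exists (expR (- (1 + `|k| / h))).
  rewrite expR_gt0 -[ltRHS]expR0 ltr_expR.
  have : 0 <= `|k| / h by rewrite divr_ge0 // ltW.
  lra.
move=> e /andP[e0 lte].
have kh : 0 <= `|k| / h by rewrite divr_ge0 // ltW.
have lne : 1 + `|k| / h < - ln e.
  by rewrite ltrNr -[ltRHS]expRK ltr_ln ?posrE ?expR_gt0.
split; first lra.
apply: le_trans (ler_norm k) _.
have -> : `|k| = h * (`|k| / h) by field; rewrite gt_eqF.
by rewrite ler_wpM2l //; lra.
Qed.

Variables (T : Type) (d : T -> T -> R) (A : set T) (alpha z : R).
Hypothesis alpha01 : 0 < alpha < 1.
Hypothesis z01 : 0 < z < 1.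

Local Notation v := (ln z / ln alpha).

(** Supplies the upper bounds: since [z = alpha^v], the number of balls is at most a multiple of
    their radius to the power [-v]. *)
Hypothesis small_covers : exists2 C, 0 < C & forall m, exists n c,
  [/\ n%:R <= C * z ^- m, forall i, (i < n)%N -> A (c i)
    & A `<=` \bigcup_(i in `I_n) cball d (c i) (alpha ^+ m)].

(** Supplies the lower bounds for both kinds of dimension. *)
Hypothesis big_covers : forall del, 0 <= del < v -> exists2 k, 0 < k &
  forall D c rad, is_cover d A D c rad ->
    (k%:E <= \esum_(i in D) (rad i `^ del)%:E)%E.

Let lna : ln alpha < 0. Proof. exact: ln_lt0. Qed.
Let a0 : 0 < alpha. Proof. by case/andP: alpha01. Qed.
Let z0 : 0 < z. Proof. by case/andP: z01. Qed.
Let v0 : 0 < v.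
Proof. by rewrite -mulrNN -invrN mulr_gt0 ?invr_gt0 ?oppr_gt0 // ln_lt0. Qed.
Let vE : ln z = v * ln alpha. Proof. by rewrite mulfVK // lt_eqF. Qed.

(** For [n] balls of radius at most [e] the sum of powers is at most [n] times [e] to the power
    [del], so a lower bound on the sum limits [n] from below. *)
Lemma covering_number_ge del k e : 0 <= del -> 0 < e ->
  (forall D c rad, is_cover d A D c rad ->
    (k%:E <= \esum_(i in D) (rad i `^ del)%:E)%E) ->
  ((k / e `^ del)%:E <= covering_number d A e)%E.
Proof.
move=> del0 e0 H; apply: le_ereal_inf_tmp => _ [n [c [rad [cov re]]] <-].
rewrite lee_fin ler_pdivrMr ?powR_gt0 // -lee_fin.
apply: le_trans (H _ _ _ cov) _.
apply: (@le_trans _ _ (\esum_(i in `I_n) (e `^ del)%:E)%E).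
  apply: le_esum => i lti; rewrite lee_fin ge0_ler_powR ?nnegrE //.
  - by apply/ltW/(cov.1 i lti).2.
  - exact: ltW.
  - exact: re.
rewrite esum_fset => [||i _]; rewrite ?lee_fin ?powR_ge0 //.
by rewrite -fsbig_ord sumEFin sumr_const card_ord mulr_natl.
Qed.

Lemma covering_number_le n c m e : (forall i, (i < n)%N -> A (c i)) ->
  A `<=` \bigcup_(i in `I_n) cball d (c i) (alpha ^+ m) -> alpha ^+ m <= e ->
  (covering_number d A e <= n%:R%:E)%E.
Proof.
move=> Ac cov me; apply: ereal_inf_lbound; exists n => //.
exists c, (fun=> alpha ^+ m); split => //; split => // i lti.
by split; [exact: Ac|exact: exprn_gt0].
Qed.

Lemma covering_number_fin e : 0 < e < 1 ->
  exists2 N : R, 0 < N & covering_number d A e = N%:E.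
Proof.
move=> e01; have [m /andP[me _]] := expr_bracket alpha01 e01.
have /andP[e0 _] := e01.
have [C C0 /(_ m.+1)[n [c [_ Ac cov]]]] := small_covers.
have H1 := covering_number_le Ac cov me.
(* With exponent 0 the sum counts the balls, so the covering number is positive and has a finite
   logarithm. *)
have [|k k0 /(covering_number_ge (lexx 0) e0)] := big_covers (del := 0).
  by rewrite lexx.
rewrite powRr0 divr1.
move: H1; case: covering_number => // N _; rewrite lee_fin => kN.
by exists N => //; exact: lt_le_trans kN.
Qed.

Lemma box_ratioE e N : 0 < - ln e -> 0 < N -> covering_number d A e = N%:E ->
  box_ratio d A e = (ln N / - ln e)%:E.
Proof.
by move=> le N0 NE; rewrite /box_ratio NE lne_EFin // inver gt_eqF.
Qed.

Lemma lower_box_ge : (v%:E <= lower_box_dim d A)%E.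
Proof.
apply: limf_einf_ge => w wv.
(* The midpoint lies strictly between [w] and [v]; the maximum with 0 makes it an admissible
   exponent. *)
pose del := Num.max 0 ((w + v) / 2).
have del0 : 0 <= del by rewrite le_max lexx.
have delv : del < v by rewrite gt_max v0 /=; lra.
have wdel : 0 < del - w.
  have : (w + v) / 2 <= del by rewrite le_max lexx orbT.
  lra.
have [|k k0 Hk] := big_covers (del := del); first by rewrite del0.
have [e0 /andP[e00 e01] He] := neg_ln_large (- ln k) wdel.
exists e0 => // e /andP[ep ee0]; have [le1 le2] := He e (introT andP (conj ep ee0)).
have [|N N0 NE] := @covering_number_fin e; first by rewrite ep; lra.
rewrite (box_ratioE le1 N0 NE) lee_fin ler_pdivlMr //.
have := covering_number_ge del0 ep Hk; rewrite NE lee_fin.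
rewrite -ler_ln ?posrE ?divr_gt0 ?powR_gt0 // ln_div ?posrE ?powR_gt0 // ln_powR.
move: le2; rewrite mulrBl; lra.
Qed.

Lemma upper_box_le : (upper_box_dim d A <= v%:E)%E.
Proof.
apply: limf_esup_le => w wv; have [C C0 HC] := small_covers.
(* The term [- v * ln alpha] pays for using radius [alpha ^+ m.+1] when [e] is only known to be
   below [alpha ^+ m]. *)
have [|e0 /andP[e00 e01] He] := @neg_ln_large (ln C - v * ln alpha) (w - v).
  lra.
exists e0 => // e /andP[ep ee0]; have [le1 le2] := He e (introT andP (conj ep ee0)).
have e11 : 0 < e < 1 by rewrite ep; lra.
have [N N0 NE] := covering_number_fin e11.
have [m /andP[me em]] := expr_bracket alpha01 e11.
rewrite (box_ratioE le1 N0 NE) lee_fin ler_pdivrMr //.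
have [n [c [nC Ac cov]]] := HC m.+1.
have := covering_number_le Ac cov me; rewrite NE lee_fin.
move=> /le_trans /(_ nC).
rewrite -ler_ln ?posrE ?divr_gt0 ?exprn_gt0 // ln_div ?posrE ?exprn_gt0 //.
rewrite lnXn // vE => lN.
have : ln e < ln alpha *+ m.
  by rewrite -lnXn // ltr_ln ?posrE ?exprn_gt0.
have vv := v0.
rewrite -mulr_natl => lem; move: lN le2.
rewrite -mulr_natl -natr1.
have : v * ln e <= v * (m%:R * ln alpha) by rewrite ler_wpM2l // ltW.
lra.
Qed.

(** The cover by balls of radius [alpha ^+ m] has a sum of at most [C * q ^+ m], where [q] is
    [alpha] to the power [del] divided by [z], and [q < 1] because [del] exceeds [v]. *)
Lemma hausdorff_pre_eq0 del e : v < del -> 0 < e -> hausdorff_pre d A del e = 0%E.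
Proof.
move=> vd e0; have [C C0 HC] := small_covers.
apply/eqP; rewrite eq_le; apply/andP; split; last first.
  apply: le_ereal_inf_tmp => _ [D [c [rad [_ _ ->]]]].
  by apply: esum_ge0 => i _; rewrite lee_fin powR_ge0.
apply/lee_addgt0Pr => h h0; rewrite add0e.
pose q := alpha `^ del / z.
have q0 : 0 < q by rewrite divr_gt0 ?powR_gt0.
have q1 : q < 1.
  rewrite ltr_pdivrMr // mul1r -ltr_ln ?posrE ?powR_gt0 // ln_powR vE.
  by rewrite ltr_nM2r.
have [|N HN] := @exprn_small q (h / C) _ (divr_gt0 h0 C0).
  by rewrite q1 ltW.
have [|M HM] := @exprn_small alpha e _ e0.
  by case/andP: alpha01 => ? ?; rewrite ltW.
pose m := maxn N M; have [n [c [nC Ac cov]]] := HC m.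
apply: ge_ereal_inf.
exists (\esum_(i in `I_n) ((alpha ^+ m) `^ del)%:E)%E.
  exists `I_n, c, (fun=> alpha ^+ m); split => //.
    split => // i lti; split; [exact: Ac|exact: exprn_gt0].
  by move=> i _; apply: HM; exact: leq_maxr.
rewrite esum_fset => [||i _]; rewrite ?lee_fin ?powR_ge0 //.
rewrite -fsbig_ord sumEFin sumr_const card_ord lee_fin -mulr_natl.
have -> : (alpha ^+ m) `^ del = (alpha `^ del) ^+ m.
  rewrite -!powR_mulrn ?powR_ge0 ?(ltW a0) //.
  by rewrite -!powRrM mulrC.
have := HN m (leq_maxl _ _).
rewrite /q expr_div_n ltr_pdivlMr // => /ltW; apply: le_trans.
apply: le_trans (ler_wpM2r _ nC) _; first by rewrite exprn_ge0 ?powR_ge0.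
by rewrite le_eqVlt; apply/orP; left; apply/eqP; ring.
Qed.

(** Monotonicity guarantees that the limit defining the Hausdorff measure exists. *)
Lemma hausdorff_pre_mono del :
  {in `]0, +oo[%R &, nonincreasing_fun (hausdorff_pre d A del)}.
Proof.
move=> e1 e2 _ _ e12; apply: le_ereal_inf_tmp => x [D [c [rad [cov re xE]]]].
apply: ereal_inf_lbound; exists D, c, rad; split => // i /re re1.
exact: lt_le_trans e12.
Qed.

Lemma hausdorff_dimE : hausdorff_dim d A = v%:E.
Proof.
apply/eqP; rewrite eq_le; apply/andP; split.
  apply/lee_addgt0Pr => h h0; apply: ereal_inf_lbound.
  exists (v + h); last by rewrite EFinD.
  split; first by have := v0; lra.
  apply: lim_near_cst; first exact: ereal_hausdorff.
  near=> e; apply: hausdorff_pre_eq0; first lra.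
  by near: e; exact: nbhs_right_gt.
apply: le_ereal_inf_tmp => _ [del [del0 H0] <-]; rewrite lee_fin leNgt.
apply/negP => delv; have [|k k0 Hk] := big_covers (del := del).
  by rewrite del0.
suff : (k%:E <= hausdorff_measure d A del)%E by rewrite H0 lee_fin; lra.
apply: lime_ge.
  apply/cvg_ex; eexists.
  apply: (nonincreasing_at_right_cvge (BInfty _ false)) => //.
  exact: hausdorff_pre_mono.
near=> e; apply: le_ereal_inf_tmp => _ [D [c [rad [cov _ ->]]]].
exact: Hk cov.
Unshelve. all: by end_near. Qed.

Lemma has_box_dimE : has_box_dim d A v%:E.
Proof.
have lu := limf_einf_le_esup (box_ratio d A).
split; apply/eqP; rewrite eq_le.
  by rewrite lower_box_ge andbT; apply: le_trans lu upper_box_le.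
by rewrite upper_box_le; apply: le_trans lower_box_ge lu.
Qed.

End Dim.

(** * Covers of the space of ends *)

(* If the weights [M (U i)] sum to less than [M [::]], one can descend forever
   through words whose weight exceeds the total weight of the [U i] below. *)
Lemma tree_cover (R : realType) (L : choiceType) (ch : seq L -> seq L)
    (M : seq L -> R) (D : set nat) (U : nat -> seq L) :
  (forall u, uniq (ch u)) -> (forall u, 0 <= M u) ->
  (forall u, M u <= \sum_(a <- ch u) M (rcons u a)) ->
  (\esum_(i in D) (M (U i))%:E < (M [::])%:E)%E ->
  exists xi, (forall n, xi n \in ch (mkseq xi n)) /\
    forall n i, D i -> U i <> mkseq xi n.
Proof.
move=> uch M0 Mch M1.
pose J u := D `&` [set i | prefix u (U i)].
pose W u := (\esum_(i in J u) (M (U i))%:E)%E.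
(* Each [U i] strictly below [u] lies below at most one child of [u], and [U i = u] lies below
   none. *)
have Wch u : (\sum_(a <- ch u) W (rcons u a) <= W u)%E.
  have -> : (\sum_(a <- ch u) W (rcons u a) = \sum_(a <- ch u) \esum_(i in J u)
      (if prefix (rcons u a) (U i) then (M (U i))%:E else 0))%E.
    apply: eq_bigr => a _; rewrite /W.
    have -> : J (rcons u a) = J u `&` [set i | prefix (rcons u a) (U i)].
      apply/seteqP; split => i [] => [Di ua|[Di _] ua]; split => //.
      by split => //=; apply: prefix_trans ua; exact: prefix_rcons.
    by rewrite esum_mkcondr; apply: eq_esum => i _; rewrite mem_setE.
  rewrite -esum_sum => [|i a _ _]; last by case: ifP => _; rewrite lee_fin.
  apply: le_esum => i [_ /= /prefixP[t Ui]].
  case: t Ui => [|b t] Ui.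
    rewrite big1 ?lee_fin // => a _; rewrite Ui cats0 ifF //.
    apply/negP => /size_prefix; by rewrite size_rcons ltnn.
  have E a : prefix (rcons u a) (U i) = (a == b).
    rewrite Ui -cats1 prefixE size_cat /= take_cat ltnNge leq_addr /=.
    by rewrite addKn /= take0 eqseq_cat // eqxx /= eqseq_cons andbT eq_sym.
  under eq_bigr do rewrite E.
  have [bch|bch] := boolP (b \in ch u); last first.
    rewrite big1_seq ?lee_fin // => a /andP[_ ach]; rewrite ifF //.
    by apply/negbTE; apply: contraNneq bch => <-.
  rewrite (bigD1_seq b bch (uch u)) /= eqxx big1 ?adde0 //.
  by move=> a /negbTE ->.
(* If no child kept the strict inequality, summing over the children would contradict it at [u]. *)
have step u : (W u < (M u)%:E)%E -> exists2 a, a \in ch u &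
    (W (rcons u a) < (M (rcons u a))%:E)%E.
  move=> Wu; apply: contrapT => H; move: Wu; rewrite ltNge => /negP; apply.
  apply: le_trans (Wch u); apply: (@le_trans _ _ (\sum_(a <- ch u) M (rcons u a))%:E).
    by rewrite lee_fin.
  rewrite -sumEFin big_seq [leRHS]big_seq; apply: lee_sum => a ach.
  by rewrite leNgt; apply/negP => lt; apply: H; exists a.
pose P u := (W u < (M u)%:E)%E; pose T := {u | P u}.
pose Rel (s t : T) := exists2 a, a \in ch (sval s) & sval t = rcons (sval s) a.
have step' (s : T) : {t | Rel s t}.
  case: s => u Wu; apply: cid; have [a ach Wa] := step u Wu.
  by exists (exist P _ Wa); exists a.
have W0 : (W [::] < (M [::])%:E)%E.
  apply: le_lt_trans M1; rewrite /W.
  have -> // : J [::] = D.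
  by apply/seteqP; split => [i []//|i Di]; split => //=; exact: prefix0s.
have [F [F0 FS]] := dependent_choice step' (exist P _ W0).
have /choice[xi xiP] : forall n, exists a, a \in ch (sval (F n)) /\
    sval (F n.+1) = rcons (sval (F n)) a.
  by move=> n; have [a ? ?] := FS n; exists a.
have FE n : sval (F n) = mkseq xi n.
  elim: n => [|n IH]; first by rewrite F0.
  by rewrite mkseqS -IH; case: (xiP n).
exists xi; split=> [n|n i Di Ui]; first by rewrite -FE; case: (xiP n).
(* Had the descent reached [U i], the term of index [i] alone would make [W] at least the weight
   there. *)
have := svalP (F n); rewrite /P FE -Ui ltNge => /negP; apply.
rewrite /W (esumID [set i]) => [|*]; last by rewrite lee_fin.
have -> : J (U i) `&` [set i] = [set i].
  by apply/seteqP; split => [j []//|j ->]; split => //; split => //=; exact: prefix_refl.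
rewrite esum_set1 ?lee_fin // leeDl // esum_ge0 // => *.
by rewrite lee_fin.
Qed.

(** * Counting reduced words of given length *)

Section FreeProductDim.
Variables (I : finType) (G : I -> groupType) (S : forall i, set (G i)).
Arguments S : clear implicits.
Hypothesis symS : forall i s, S i s -> S i (s^-1)%g.
Hypothesis reachS : forall i x, reachable (S i) x.
Hypothesis finS : forall i, finite_set (S i).
Hypothesis nontriv : forall i, exists x : G i, x <> 1%g.

Local Notation L i x := (@Tagged I i (fun j => G j) x).
Local Notation adj := (fp_cayley S).
Local Notation len := (fp_length S).
Local Notation llen := (letter_len S).
Local Notation wl := (wlen S).

Implicit Types (x y : free_product G) (u : seq (letter G)).

Let lenE := len_inj symS reachS.

Definition factor_sphere i k : seq (G i) :=
  fset_set [set x : G i | len (fp_inj x) = k].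

Local Notation sph := factor_sphere.
Local Notation cnt := (sphere_card S).

Lemma mem_factor_sphere i k (g : G i) :
  (g \in sph i k) = (word_length (S i) g == k).
Proof.
rewrite in_fset_set; last first.
  apply: sub_finite_set (finite_word_ball (@reachS i) (finS i) k.+1).
  by move=> h /=; rewrite lenE => ->.
by apply/idP/eqP; rewrite inE /= lenE.
Qed.

Lemma size_factor_sphere i k : size (sph i k) = cnt i k.
Proof. by []. Qed.

Lemma uniq_factor_sphere i k : uniq (sph i k).
Proof. exact: fset_uniq. Qed.

(** A non-trivial element has positive length, and the first step of a geodesic to it has length
    1. *)
Lemma sphere_card_gt0 i : (0 < cnt i 1)%N.
Proof.
have [x x1] := nontriv i.
case E : (word_length (S i) x) => [|k].
  by move/eqP: E; rewrite word_length_eq0 // => /eqP.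
have [y [_ [_ y1 _]]] := word_length_split (@reachS i) (m := 1) E.
rewrite -size_factor_sphere -has_predT; apply/hasP; exists y => //.
by rewrite mem_factor_sphere y1.
Qed.

Lemma sphere_card_submul i m n : (cnt i (m + n) <= cnt i m * cnt i n)%N.
Proof.
apply: (@leq_trans (size [seq (g * h)%g | g <- sph i m, h <- sph i n])).
  apply: (@uniq_leq_size _ (sph i (m + n))); first exact: uniq_factor_sphere.
  move=> g; rewrite mem_factor_sphere => /eqP/(word_length_split (@reachS i)).
  case=> y [z [-> ym zn]]; apply/allpairsP; exists (y, z).
  by rewrite !mem_factor_sphere /= ym zn !eqxx.
by rewrite size_allpairs.
Qed.

(** The identity is left out, so these are the admissible letters of length at most [K]. *)
Definition factor_ball i K : seq (G i) :=
  [seq g | k <- iota 1 K, g <- sph i k].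

Lemma mem_factor_ball i K (g : G i) :
  (g \in factor_ball i K) = (1 <= word_length (S i) g <= K)%N.
Proof.
apply/allpairsPdep/idP => [[k [h [kK hk ->]]]|gK].
  by move: kK hk; rewrite mem_iota mem_factor_sphere add1n ltnS => ? /eqP ->.
exists (word_length (S i) g), g; split => //.
  by rewrite mem_iota add1n ltnS.
by rewrite mem_factor_sphere.
Qed.

Lemma uniq_factor_ball i K : uniq (factor_ball i K).
Proof.
apply: (@allpairs_uniq_dep _ (fun=> G i) _ (fun _ g => g)).
- exact: iota_uniq.
- by move=> k _; exact: uniq_factor_sphere.
move=> _ _ /allpairsPdep[k [g [_ gk ->]]] /allpairsPdep[l [h [_ hl ->]]] /= gh.
by subst h; move: gk hl; rewrite !mem_factor_sphere => /eqP-> /eqP->.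
Qed.

Lemma psum_factor_ball (R : realType) i K (z : R) :
  \sum_(g <- factor_ball i K) z ^+ word_length (S i) g = psum cnt i K z.
Proof.
rewrite big_allpairs_dep /psum /index_iota subSS subn0.
apply: eq_bigr => k _.
rewrite (eq_big_seq (fun=> z ^+ k)); last first.
  by move=> g; rewrite mem_factor_sphere => /eqP ->.
by rewrite big_const_seq count_predT iter_addr_0 mulr_natl.
Qed.

Lemma word_length_ge1 i (g : G i) : g != 1%g -> (1 <= word_length (S i) g)%N.
Proof. by rewrite lt0n word_length_eq0. Qed.

(* [n] is fuel, bounding the number of letters; [m] is the length of the words
   and [i] the factor of their first letter. *)
Fixpoint words_from (n : nat) (i : I) (m : nat) : seq (seq (letter G)) :=
  if n is n'.+1 then
    flatten [seq flatten [seq [seq L i g :: w | w <-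
        if k == m then [:: [::]]
        else flatten [seq words_from n' j (m - k)%N | j <- enum I & j != i]]
      | g <- sph i k] | k <- iota 1 m]
  else [::].

Lemma size_words_from n i m : size (words_from n.+1 i m) =
  (\sum_(1 <= k < m.+1) cnt i k *
    (if k == m then 1 else \sum_(j | j != i) size (words_from n j (m - k))))%N.
Proof.
rewrite /= size_flatten sumnE /shape -map_comp big_map /index_iota subSS subn0.
apply: eq_bigr => k _ /=; rewrite size_flatten sumnE /shape -map_comp big_map.
rewrite (eq_bigr (fun=> if k == m then 1 else
  \sum_(j | j != i) size (words_from n j (m - k)))%N) => [|g _] /=.
  by rewrite big_const_seq count_predT iter_addn_0 mulnC.
rewrite size_map; case: ifP => // _.
by rewrite size_flatten sumnE /shape -map_comp big_map big_filter big_enum_cond.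
Qed.

Lemma mem_words_from n a w : reduced (a :: w) -> (size w < n)%N ->
  a :: w \in words_from n (tag a) (wl (a :: w)).
Proof.
elim: n a w => // n IH [i g] w rw wn.
have g1 : (1 <= word_length (S i) g)%N.
  by apply: word_length_ge1; move: rw; rewrite reduced_cons => /and3P[].
apply/flatten_mapP; exists (word_length (S i) g).
  by rewrite mem_iota g1 wlen_cons add1n ltnS leq_addr.
apply/flatten_mapP; exists g; first by rewrite mem_factor_sphere.
apply: map_f; rewrite wlen_cons /letter_len /=.
case: w rw wn => [|b w] rw wn; first by rewrite /wlen big_nil addn0 eqxx mem_head.
move: rw; rewrite reduced_cons => /and3P[_ ab rw].
have b1 : (1 <= llen b)%N.
  by apply: word_length_ge1; move: rw; rewrite reduced_cons => /and3P[].
rewrite ifF; last first.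
  apply/negbTE; rewrite -[X in X == _]addn0 eqn_add2l eq_sym -lt0n wlen_cons.
  by rewrite (leq_trans b1) ?leq_addr.
rewrite addKn; apply/flatten_mapP; exists (tag b); last exact: IH.
by rewrite mem_filter mem_enum andbT eq_sym.
Qed.

Lemma size_le_wlen w : reduced w -> (size w <= wl w)%N.
Proof.
elim: w => //= a w IH; rewrite reduced_cons wlen_cons => /and3P[a1 _ /IH rw].
by rewrite -add1n leq_add // word_length_ge1.
Qed.

(** An over-count suffices: the empty word is listed for every [m]. The fuel [m] is enough because
    each letter has length at least 1. *)
Definition words_of_length m : seq (seq (letter G)) :=
  [::] :: flatten [seq words_from m i m | i <- enum I].

Lemma mem_words_of_length x : word x \in words_of_length (len x).
Proof.
rewrite (len_wlen symS reachS) inE; case: x => u ru /=.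
have := size_le_wlen ru; case: u ru => //= a w rw wm.
by apply/flatten_mapP; exists (tag a); rewrite ?mem_enum //;
  exact: mem_words_from.
Qed.

Section Counting.
Variables (R : realType) (z : R).
Hypothesis z01 : 0 < z < 1.
Hypothesis fz : forall i, (gser cnt i z < +oo)%E.
Hypothesis Fz : Fser cnt z = 1.

Let s i := fine (gser cnt i z).
Let z0 : 0 <= z. Proof. by case/andP: z01 => /ltW. Qed.
Let s0 i : 0 <= s i. Proof. exact: fine_gser_ge0. Qed.

(** After a first letter from factor [i], either the word ends or it goes on in another factor. Both
    cases cost at most [C * (1 - phi (s i))], since the [phi (s j)] sum to 1; summing over the first
    letter multiplies this by at most [s i]. *)
Lemma count_words_from C n i m : (forall j, 1 <= C * (1 - phi (s j))) -> 0 <= C ->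
  (size (words_from n i m))%:R * z ^+ m <= C * phi (s i).
Proof.
move=> HC C0; elim: n i m => [|n IH] i m.
  by rewrite mul0r mulr_ge0 // phi_ge0.
rewrite size_words_from natr_sum mulr_suml.
have -> : C * phi (s i) = s i * (C * (1 - phi (s i))).
  by rewrite /phi; field; rewrite gt_eqF //; have := s0 i; lra.
apply: (@le_trans _ _ (psum cnt i m z * (C * (1 - phi (s i))))); last first.
  by rewrite ler_wpM2r ?psum_le_fine // (le_trans ler01).
rewrite /psum mulr_suml big_nat [leRHS]big_nat; apply: ler_sum => k /andP[k0].
rewrite ltnS => km; rewrite natrM -!mulrA ler_wpM2l //.
case: eqP => [->|_]; first by rewrite mul1r -[leLHS]mulr1 ler_wpM2l ?exprn_ge0.
rewrite -{2}(subnKC km) exprD mulrCA ler_wpM2l ?exprn_ge0 //.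
rewrite natr_sum mulr_suml; apply: le_trans (ler_sum _ (fun j _ => IH j _)) _.
rewrite -mulr_sumr ler_wpM2l //.
by have := Fz; rewrite /Fser (bigD1 i) //= => <-; rewrite addrAC subrr add0r.
Qed.

Lemma count_words : exists2 C, 0 < C & forall m,
  (size (words_of_length m))%:R <= C * z ^- m.
Proof.
(* [1 - phi (s j)] is the inverse of [1 + s j], and [C] dominates every [1 + s j]. *)
pose C := 1 + \sum_i s i.
have C1 : 1 <= C by rewrite lerDl sumr_ge0.
exists (1 + C) => [|m]; first lra.
rewrite ler_pdivlMr ?exprn_gt0 //; last by case/andP: z01.
rewrite /= size_flatten sumnE /shape -map_comp big_map big_enum /=.
rewrite -natr1 natr_sum mulrDl mul1r addrC lerD //.
  by rewrite exprn_ile1 //; case/andP: z01 => _ /ltW.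
apply: (@le_trans _ _ (C * Fser cnt z)); last by rewrite Fz mulr1.
rewrite mulr_suml /Fser mulr_sumr; apply: ler_sum => i _.
apply: count_words_from; last lra.
move=> j; rewrite phiE // opprB addrC subrK ler_pdivlMr ?mul1r; last first.
  by have := s0 j; lra.
rewrite /C lerD2l (bigD1 j) //= lerDl; exact: sumr_ge0.
Qed.

End Counting.

(** * Upper and lower estimates for covers of the ends *)

Let adjC := cayleyC (free_gens_sym symS).
Let reachG := reachable_fp reachS.
Let finG := finite_fp_ball reachS finS.

Section Covers.
Variables (R : realType) (alpha : R).
Hypothesis alpha01 : 0 < alpha < 1.

Local Notation dist := (fp_end_dist S alpha).

(** Ends whose tails are joined, outside the ball, to the same vertex of the sphere are within
    [alpha ^+ m] of each other. One ball per listed word therefore suffices. *)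
Lemma fp_small_covers (z : R) (A : set (fp_end S)) (w0 : fp_end S) : A w0 ->
  0 < z < 1 -> (forall i, gser cnt i z < +oo)%E -> Fser cnt z = 1 ->
  exists2 C, 0 < C & forall m, exists n c,
    [/\ n%:R <= C * z ^- m, forall i, (i < n)%N -> A (c i)
      & A `<=` \bigcup_(i in `I_n) cball dist (c i) (alpha ^+ m)].
Proof.
move=> Aw0 z01 fz Fz; have [C C0 HC] := count_words z01 fz Fz.
exists C => // m; pose ws := words_of_length m.
pose through u (w : fp_end S) := exists f, [/\ in_end f w, A w &
  exists2 y, word y = u & exists N, forall j, (N <= j)%N ->
    connected_in adj (~` open_ball adj 1%g m) y (f j)].
have /choice[c cP] : forall i : nat, exists w, A w /\
    forall w', through (nth [::] ws i) w' -> dist w w' <= alpha ^+ m.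
  move=> i; have [[w [f [fw Aw [y yi [N HN]]]]]|nw] :=
    pselect (exists w, through (nth [::] ws i) w).
    exists w; split => // w' [g [gw' _ [y' y'i [N' HN']]]].
    have yy : y' = y by apply: val_inj; rewrite /= y'i.
    rewrite yy in HN'.
    apply/(end_dist_le adjC reachG finG m alpha01 fw gw').
    exists (maxn N N') => j k; rewrite !geq_max => /andP[jN _] /andP[_ kN].
    apply: connected_in_trans (HN' k kN); apply: connected_in_sym => //.
    exact: HN.
  (* A word that no end of [A] uses gets the default centre [w0], since all centres must lie in
     [A]. *)
  by exists w0; split => // w' tw'; case: nw; exists w'.
exists (size ws), c; split => [|i _|w Aw]; first exact: HC.
  by have [] := cP i.
have [f fw] := end_nonempty adjC finG w.
have [y ym [N HN]] := end_sphere adjC reachG finG m fw.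
have yws : word y \in ws by rewrite /ws -ym; exact: mem_words_of_length.
exists (index (word y) ws); first by move: yws; rewrite -index_mem.
apply: (cP _).2; rewrite nth_index //; exists f; split => //.
by exists y => //; exists N.
Qed.

Section Mass.
Variables (t k : R) (K : nat).
Hypothesis t0 : 0 < t.
Hypothesis k0 : 0 <= k.
Hypothesis F1 : 1 <= Fsum cnt K t.

Definition can_follow u j :=
  if u is a :: u' then tag (last a u') != j else true.

(** The length bound [K] makes the tree of reduced words finitely branching. *)
Definition children u : seq (letter G) :=
  [seq L j g | j <- [seq j <- enum I | can_follow u j], g <- factor_ball j K].

Lemma mem_children u a :
  (a \in children u) = can_follow u (tag a) && (1 <= llen a <= K)%N.
Proof.
apply/allpairsPdep/andP => [[j [g [uj gK ->]]]|[ua aK]].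
  by move: uj gK; rewrite mem_filter mem_factor_ball => /andP[].
exists (tag a), (tagged a); rewrite mem_filter ua mem_enum mem_factor_ball.
by split => //; case: (a).
Qed.

Lemma uniq_children u : uniq (children u).
Proof.
apply: (@allpairs_uniq_dep _ (fun j => G j) _ (fun j g => L j g)).
- by rewrite filter_uniq // enum_uniq.
- by move=> j _; exact: uniq_factor_ball.
by move=> [j g] [j' g'] _ _.
Qed.

(* The weights solve the self-consistency equation of the truncated growth
   series, so that a word weighs at most as much as its one-letter extensions. *)
Definition mass u := k * t ^+ wl u *
  (if u is a :: u' then 1 - phi (psum cnt (tag (last a u')) K t) else 1).

Lemma mass_rcons u a : mass (rcons u a) =
  k * t ^+ wl u * (t ^+ llen a * (1 - phi (psum cnt (tag a) K t))).
Proof.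
rewrite /mass wlen_rcons exprD; case: u => [|b u] /=; rewrite ?last_rcons; ring.
Qed.

Lemma mass_ge0 u : 0 <= mass u.
Proof.
rewrite !mulr_ge0 ?exprn_ge0 ?(ltW t0) //; case: u => // a u.
by rewrite subr_ge0 ltW // phi_lt1 // psum_ge0 // ltW.
Qed.

Lemma mass_le u : mass u <= k * t ^+ wl u.
Proof.
rewrite -[leRHS]mulr1 ler_wpM2l ?mulr_ge0 ?exprn_ge0 ?(ltW t0) //.
by case: u => // a u; rewrite gerBl phi_ge0 // psum_ge0 // ltW.
Qed.

(** With [p] the truncated series of a factor, [p * (1 - phi p) = phi p]. By [F1], the factors
    allowed after [u] thus contribute at least 1, or 1 minus [phi] of the one excluded by the last
    letter. *)
Lemma mass_children u : mass u <= \sum_(a <- children u) mass (rcons u a).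
Proof.
pose y j := phi (psum cnt j K t).
have p0 j : 0 <= psum cnt j K t by rewrite psum_ge0 // ltW.
rewrite big_allpairs_dep (eq_bigr (fun j => k * t ^+ wl u * y j)); last first.
  move=> j _; under eq_bigr do rewrite mass_rcons /=.
  rewrite -mulr_sumr; congr (_ * _); rewrite -mulr_suml psum_factor_ball.
  by rewrite /y /phi; field; rewrite gt_eqF //; have := p0 j; lra.
rewrite -mulr_sumr ler_wpM2l ?mulr_ge0 ?exprn_ge0 ?(ltW t0) //.
rewrite big_filter big_enum_cond; case: u => [|a u] /=; first exact: F1.
rewrite lerBlDl; apply: le_trans F1 _; rewrite /Fsum (bigD1 (tag (last a u))) //=.
by under [in leRHS]eq_bigl do rewrite eq_sym.
Qed.

End Mass.

Definition short_word K (xi : nat -> letter G) :=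
  infinite_word xi /\ forall n, (llen (xi n) <= K)%N.

(** The longest prefix of length below [m] works, since the next letter adds at most [K]. The
    alternative [n = 0] serves [m = 0]. *)
Lemma short_prefix K xi m : short_word K xi -> exists n,
  (n = 0%N \/ (wl (mkseq xi n) < m)%N) /\ (m <= wl (mkseq xi n) + K)%N.
Proof.
case=> Hxi xiK; case: m => [|m]; first by exists 0%N; split => //; left.
have P0 : exists n, (wl (mkseq xi n) < m.+1)%N by exists 0%N; rewrite /wlen big_nil.
have Pm n : (wl (mkseq xi n) < m.+1)%N -> (n <= m)%N.
  rewrite ltnS; apply: leq_trans; rewrite -{1}(size_mkseq xi n).
  by apply: size_le_wlen; exact: mkseq_reduced.
case: (ex_maxnP P0 Pm) => n nm nmax; exists n; split; first by right.
have : ~~ (wl (mkseq xi n.+1) < m.+1)%N.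
  by apply/negP => /nmax; rewrite ltnn.
rewrite -leqNgt mkseqS wlen_rcons => /leq_trans; apply.
by rewrite leq_add2l.
Qed.

(** Each ball met by a short word is replaced by a common prefix of the infinite words in it, with
    mass at most the term of the ball. If the sum were below [k], [tree_cover] would give a short
    infinite word whose end lies in no ball. *)
Lemma fp_big_covers (z : R) (A : set (fp_end S)) del :
  Omega_infty S `<=` A -> 0 <= del -> z < alpha `^ del ->
  (forall z', z < z' -> exists K, 1 < Fsum cnt K z') ->
  exists2 k, 0 < k & forall D c rad,
    is_cover dist A D c rad ->
    (k%:E <= \esum_(i in D) (rad i `^ del)%:E)%E.
Proof.
have [a0 a1] := andP alpha01.
move=> OA del0 zt /(_ _ zt)[K /ltW F1]; set t := alpha `^ del in zt F1.
have t0 : 0 < t by exact: powR_gt0.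
have t1 : t <= 1.
  by rewrite -(powRr0 alpha) ger_powR // a0 ltW.
have tX n : t ^+ n = (alpha ^+ n) `^ del.
  by rewrite -!powR_mulrn ?powR_ge0 ?(ltW a0) // -!powRrM mulrC.
(* The factor [t ^+ K] compensates for a prefix up to [K] shorter than [m], and one more [t] for
   bounding [rad i] below by [alpha ^+ m.+1]. *)
pose k := t ^+ K.+1; have k0 : 0 < k by exact: exprn_gt0.
exists k => // D c rad [Drad cov].
pose hit i xi := exists f w, [/\ is_ray adj f, runs_along f xi, in_end f w
  & dist (c i) w <= rad i].
(* Only balls met by a short word yield a prefix; dropping the others can only decrease the sum. *)
pose D' := D `&` [set i | exists2 xi, short_word K xi & hit i xi].
have /choice[U UP] : forall i, exists u, D' i -> mass t k K u <= rad i `^ del /\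
    forall xi, hit i xi -> exists n, u = mkseq xi n.
  move=> i; have [D'i|nD'i] := pselect (D' i); last by exists [::].
  case: (D'i) => Di [xi0 sxi0 [f0 [w0 [rf0 fxi0 fw0 dw0]]]].
  have r0 := (Drad i Di).2.
  (* A ball of radius at least 1 gets the empty word, whose mass [k] is at most 1. *)
  have [r1|r1] := leP 1 (rad i).
    exists [::] => _; split; last by move=> xi _; exists 0%N.
    rewrite /mass /wlen big_nil expr0 !mulr1.
    apply: (@le_trans _ _ 1); first by rewrite exprn_ile1 // ltW.
    have := ge0_ler_powR del0 (x := 1) (y := rad i).
    by rewrite powR1 !nnegrE ler01 (ltW r0); exact.
  have [|m /andP[mr rm]] := @expr_bracket _ alpha (rad i) alpha01; first exact/andP.
  have [n [n0 nK]] := short_prefix m sxi0.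
  exists (mkseq xi0 n) => _; split.
    apply: le_trans (mass_le _ _ _ _) _ => //; first exact: ltW.
    rewrite -exprD; apply: (@le_trans _ _ (t ^+ m.+1)).
      by rewrite ler_wiXn2l ?(ltW t0) // addSn ltnS addnC.
    by rewrite tX ge0_ler_powR ?nnegrE ?exprn_ge0 ?(ltW a0) ?(ltW r0).
  move=> xi [f [w [rf fxi fw dw]]].
  case: n0 => [->|nm]; first by exists 0%N.
  exists n; have [g gc] := end_nonempty adjC finG (c i).
  apply: (same_tail_prefix symS reachS fxi0 fxi _ nm).
  (* Both ends are nearer than [alpha ^+ m] to the centre, so their tails are compared through a ray
     [g] of the centre. *)
  apply: (@same_tail_trans _ _ _ g).
    apply: same_tailC => //.
    apply: (end_dist_lt adjC reachG finG alpha01 gc fw0).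
    exact: le_lt_trans rm.
  apply: (end_dist_lt adjC reachG finG alpha01 gc fw).
  exact: le_lt_trans rm.
rewrite leNgt; apply/negP => lt.
have lt' : (\esum_(i in D') (mass t k K (U i))%:E < (mass t k K [::])%:E)%E.
  rewrite {2}/mass /wlen big_nil expr0 !mulr1; apply: le_lt_trans lt.
  apply: (@le_trans _ _ (\esum_(i in D') (rad i `^ del)%:E)%E).
    by apply: le_esum => i /UP[]; rewrite lee_fin.
  rewrite [leRHS](esumID [set i | exists2 xi, short_word K xi & hit i xi]).
    by rewrite leeDl // esum_ge0 // => i _; rewrite lee_fin powR_ge0.
  by move=> i _; rewrite lee_fin powR_ge0.
have [xi [xich xiU]] := tree_cover (uniq_children K)
  (mass_ge0 K t0 (ltW k0)) (mass_children t0 (ltW k0) F1) lt'.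
have sxi : short_word K xi.
  split=> n; have := xich n; rewrite mem_children => /andP[_ /andP[xi1 xiK]] //.
  split.
    by apply/eqP => x1; move: xi1; rewrite /letter_len x1 word_length1.
  have := xich n.+1; rewrite mem_children => /andP[+ _].
  by rewrite mkseqS; case: (mkseq xi n) => [|b u] //=; rewrite last_rcons.
have [f rf fxi] := word_ray symS reachS sxi.1.
have [w fw] := end_of_ray adjC finG rf.
have Ow : Omega_infty S w by exists xi; [exact: sxi.1|exists f].
have [i Di dw] := cov w (OA w Ow).
have hi : hit i xi by exists f, w.
have D'i : D' i by split => //; exists xi.
by have [_ /(_ xi hi)[n Un]] := UP i D'i; exact: xiU D'i Un.
Qed.

End Covers.

End FreeProductDim.

(** * The growth sum at 1 *)

Lemma card_setT2 (T : choiceType) (a b : T) : a != b ->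
  (forall x, x = a \/ x = b) -> ([set: T] #= `I_2)%card.
Proof.
move=> ab H.
have -> : [set: T] = [set a; b] by apply/seteqP; split => x // _; exact: H.
have fab : finite_set [set a; b] by rewrite finite_setU; split; exact: finite_set1.
apply/(fcard_eq fab (finite_II 2)).
rewrite (card_fset_set (card_eqxx `I_2)) fset_setU ?fset_set1 //; try exact: finite_set1.
by rewrite cardfs2 ab.
Qed.

Section FreeProductCritical.
Variables (I : finType) (G : I -> groupType) (S : forall i, set (G i)).
Arguments S : clear implicits.
Hypothesis symS : forall i s, S i s -> S i (s^-1)%g.
Hypothesis reachS : forall i x, reachable (S i) x.
Hypothesis finS : forall i, finite_set (S i).
Hypothesis nontriv : forall i, exists x : G i, x <> 1%g.

Local Notation cnt := (sphere_card S).

Lemma psum1E (R : realType) i K :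
  psum cnt i K (1 : R) = (size (factor_ball S i K))%:R.
Proof.
rewrite -(psum_factor_ball symS reachS finS); under eq_bigr do rewrite expr1n.
by rewrite big_const_seq count_predT iter_addr_0.
Qed.

Lemma phi_psum_ge (R : realType) i K n : (n <= size (factor_ball S i K))%N ->
  n%:R / (1 + n%:R) <= phi (psum cnt i K (1 : R)).
Proof. by move=> nK; rewrite -/(phi _) ler_phi // psum1E ler_nat. Qed.

Lemma factor_ball_gt0 i K : (0 < size (factor_ball S i K.+1))%N.
Proof.
rewrite size_allpairs_dep sumnE big_map /= big_cons.
by rewrite (leq_trans (sphere_card_gt0 symS reachS finS nontriv i)) ?leq_addr.
Qed.

(** At 1 each factor contributes at least 1/2, so three factors exceed 1. Of two factors, not both
    of order 2, one has two non-trivial elements and contributes at least 2/3. *)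
Lemma Fsum1_gt1 (R : realType) : (2 <= #|I|)%N ->
  ~ (#|I| = 2%N /\ forall i, ([set: G i] #= `I_2)%card) ->
  exists K, 1 < Fsum cnt K (1 : R).
Proof.
move=> I2 nI2.
have half i K : 1 / 2 <= phi (psum cnt i K.+1 (1 : R)).
  exact: (phi_psum_ge R (n := 1) (factor_ball_gt0 i K)).
have [I3|] := leqP 3 #|I|.
  exists 1%N; apply: (@lt_le_trans _ _ (\sum_(i : I) (1 / 2))).
    rewrite sumr_const -mulr_natl; have : 3 <= #|I|%:R :> R by rewrite ler_nat.
    lra.
  by apply: ler_sum => i _; exact: half.
move=> I3; have {I3}I2' : #|I| = 2%N by apply/eqP; rewrite eqn_leq -ltnS I3.
have [i [x [y [x1 y1 xy]]]] : exists i, exists x y : G i,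
    [/\ x != 1%g, y != 1%g & x != y].
  apply: contrapT => H; apply: nI2; split => // i.
  have [a a1] := nontriv i.
  apply: (@card_setT2 _ a 1%g) => [|x]; first exact/eqP.
  have [->|x1] := eqVneq x 1%g; [by right|left].
  apply/eqP; apply/negP => /negP xa; apply: H; exists i, x, a.
  by split => //; exact/eqP.
pose K := maxn (word_length (S i) x) (word_length (S i) y); exists K.+1.
have sz : (2 <= size (factor_ball S i K.+1))%N.
  apply: (@uniq_leq_size _ [:: x; y]); first by rewrite /= inE xy.
  move=> g; rewrite !inE (mem_factor_ball symS reachS finS).
  by case/orP => /eqP->; rewrite word_length_ge1 //= leqW // leq_max leqnn ?orbT.
rewrite /Fsum (bigD1 i) //=.
have := phi_psum_ge R sz; rewrite nat1r.
have : \sum_(j | j != i) (1 / 2) <= \sum_(j | j != i) phi (psum cnt j K.+1 (1 : R)).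
  by apply: ler_sum => j _; exact: half.
have -> : \sum_(j | j != i) (1 / 2) = 1 / 2 :> R.
  by rewrite sumr_const cardC1 I2'.
lra.
Qed.

End FreeProductCritical.

(** * The four dimensions *)

Theorem theorem3p8 (R : realType) (r : nat) (G : 'I_r -> groupType)
    (S : forall i, set (G i)) (alpha : R) :
  (2 <= r)%N ->
  (forall i, exists x : G i, x <> 1%g) ->
  ~ (r = 2%N /\ forall i, ([set: G i] #= `I_2)%card) ->
  (forall i, finite_set (S i)) ->
  (forall i s, S i s -> S i (s^-1)%g) ->
  (forall i, ~ S i 1%g) ->
  (forall i, generates (S i)) ->
  0 < alpha < 1 ->
  exists z : R, smallest_growth_solution S z /\
    let d := fp_end_dist S alpha in
    let v := (ln z / ln alpha)%:E in
    [/\ has_box_dim d (Omega S) v,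
        has_box_dim d (Omega_infty S) v,
        hausdorff_dim d (Omega S) = v
      & hausdorff_dim d (Omega_infty S) = v].
Proof.
move=> r2 nontriv excl finS symS _ genS alpha01.
have reachS i x : reachable (S i) x.
  by move: x; apply/generates_reachable => //; exact: symS.
have cI : #|'I_r| = r by exact: card_ord.
have a1 := sphere_card_gt0 symS reachS finS nontriv.
have I2 (i : 'I_r) : exists j, j != i.
  have : (0 < #|predC1 i|)%N by rewrite cardC1 cI -ltnS prednK // ltnW.
  by case/card_gt0P => j; exists j.
have I1 : exists i : 'I_r, True by exists (Ordinal (ltnW r2)).
have [|z [z01 fz Fz zmin above]] := growth_solution_exists a1
  (sphere_card_submul symS reachS finS) I2 I1 (R := R).
  by apply: Fsum1_gt1 => //; rewrite cI.
exists z; split.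
  split; first by split => //; case/andP: z01.
  by move=> z' [z'0 fz' Fz']; exact: zmin.
have [z0 z1] := andP z01; have [al0 al1] := andP alpha01.
(* A word alternating between two factors provides a point of [Omega_infty], used as default
   centre. *)
have [w0 Ow0] : exists w, Omega_infty S w.
  have [i _] := I1; have [j /negbTE ji] := I2 i.
  have [g /eqP/negbTE g1] := nontriv i; have [h /eqP/negbTE h1] := nontriv j.
  pose xi n : letter G := if odd n then Tagged (fun i => G i) g else Tagged (fun i => G i) h.
  have Hxi : infinite_word xi.
    by move=> n; rewrite /xi /=; case: (odd n); rewrite /= ?g1 ?h1 ?[i == j]eq_sym ji.
  have [f rf fxi] := word_ray symS reachS Hxi.
  have [w fw] := end_of_ray (cayleyC (free_gens_sym symS)) (finite_fp_ball reachS finS) rf.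
  by exists w, xi => //; exists f.
(* Both sets contain [Omega_infty], so one argument serves them. *)
have dims A : A w0 -> Omega_infty S `<=` A ->
    has_box_dim (fp_end_dist S alpha) A (ln z / ln alpha)%:E /\
    hausdorff_dim (fp_end_dist S alpha) A = (ln z / ln alpha)%:E.
  move=> Aw0 OA.
  have small := fp_small_covers symS reachS finS alpha01 Aw0 z01 fz Fz.
  have bigA del : 0 <= del < ln z / ln alpha -> exists2 k, 0 < k &
      forall D c rad, is_cover (fp_end_dist S alpha) A D c rad ->
      (k%:E <= \esum_(i in D) (rad i `^ del)%:E)%E.
    move=> /andP[del0 delv].
    (* Multiplying by the negative [ln alpha] turns the upper bound on [del] into this
       inequality. *)
    have zdel : z < alpha `^ del.
      rewrite -ltr_ln ?posrE ?powR_gt0 // ln_powR -ltr_ndivlMr //.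
      exact: ln_lt0.
    exact: (fp_big_covers symS reachS finS alpha01 OA del0 zdel above).
  by split; [exact: has_box_dimE|exact: hausdorff_dimE].
have [b1 h1] := dims (Omega S) I (fun _ _ => I).
have [b2 h2] := dims (Omega_infty S) Ow0 (fun _ => id).
by split.
Qed.
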